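(* Let $m\ge2$, let $J_1,\dots,J_m\subset(-1,0)\cup(0,1)$ be intervals, and let $d_k:J_1\times\dots\times J_m\to\mathbb{R}$, $k=1,\dots,m$, be $C^1$ functions. For $\Lambda=(\lambda_1,\dots,\lambda_m)\in J_1\times\dots\times J_m$ put $\varphi_{k,\Lambda}(x)=\lambda_kx+d_k(\Lambda)$, and suppose that for every such $\Lambda$ one has $\varphi_{k,\Lambda}([0,1])\subseteq[0,1]$ for all $k$ and $\varphi_{i,\Lambda}([0,1])\cap\varphi_{j,\Lambda}([0,1])=\emptyset$ for $i\neq j$. Let $K_\Lambda$ be the affine Cantor set generated by $\varphi_{1,\Lambda},\dots,\varphi_{m,\Lambda}$. Let $K\subset\mathbb{R}$ be a compact set such that $$\dim_HK+\dim_HK_\Lambda>1\quad\text{for all }\Lambda=(\lambda_1,\dots,\lambda_m)\in J_1\times\dots\times J_m.$$ Then for Lebesgue-a.e. $(\lambda_1,\dots,\lambda_m)\in J_1\times\dots\times J_m$ the set $K+K_\Lambda=\{x+y:x\in K,\ y\in K_\Lambda\}$ has positive Lebesgue measure.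
   Context: $\dim_H$ is Hausdorff dimension. The Cantor set generated by contractions $\varphi_1,\dots,\varphi_m:[0,1]\to[0,1]$ with pairwise disjoint images is $\bigcap_{n\ge0}I_n$, where $I_0=[0,1]$ and $I_{n+1}=\bigcup_{k=1}^m\varphi_k(I_n)$. It is called affine if all $\varphi_k$ are affine (not necessarily with the same contraction coefficients). *)

(* Defs.v *)
From HB Require Import structures.
From mathcomp Require Import all_boot all_order all_algebra.
From mathcomp Require Import all_classical all_reals all_analysis.

Set Implicit Arguments.
Unset Strict Implicit.
Unset Printing Implicit Defensive.

Import Order.TTheory GRing.Theory Num.Theory.
Import numFieldNormedType.Exports.

Local Open Scope classical_set_scope.
Local Open Scope ring_scope.

Section hausdorff.
Context {R : realType}.
Implicit Types (s delta : R) (A U : set R).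
Local Open Scope ereal_scope.

(* [diam set0] is -oo, hence the separate case for set0 in [diam_pow]; for
   s = 0 a nonempty set has weight 1, so that s = 0 is the counting measure. *)
Definition diam U : \bar R :=
  ereal_sup [set `|x - y|%:E | x in U & y in U].

Definition diam_pow s U : \bar R :=
  if U == set0 then 0 else poweR (diam U) s.

Definition delta_cover delta A : set ((set R)^nat) :=
  [set U | A `<=` \bigcup_k U k /\ forall k, diam (U k) <= delta%:E].

Definition hausdorff_premeasure s delta A : \bar R :=
  ereal_inf [set \sum_(0 <= k <oo) diam_pow s (U k) | U in delta_cover delta A].

Definition hausdorff_measure s A : \bar R :=
  ereal_sup [set hausdorff_premeasure s delta A | delta in [set d | (0 < d)%R]].

Definition hausdorff_dim A : \bar R :=
  ereal_inf [set s%:E | s in [set s | (0 <= s)%R /\ hausdorff_measure s A = 0]].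

End hausdorff.

Section cantor.
Context {R : realType} {m : nat}.

Fixpoint cantor_level (phi : 'I_m -> R -> R) (n : nat) : set R :=
  if n is n'.+1 then
    \bigcup_(k in [set: 'I_m]) (phi k @` cantor_level phi n')
  else `[0, 1].

Definition cantor_set (phi : 'I_m -> R -> R) : set R :=
  \bigcap_n cantor_level phi n.

Definition box (J : 'I_m -> interval R) : set 'rV[R]_m :=
  [set L | forall k, L ord0 k \in J k].

Definition affine_maps (d : 'I_m -> 'rV[R]_m -> R) (L : 'rV[R]_m)
    (k : 'I_m) (x : R) : R := L ord0 k * x + d k L.

(* The box need not be open: differentiability is relative to [A], with
   partial derivatives [g i] continuous on [A].  At interior points of [A] this
   is ordinary continuous differentiability; values outside [A] play no role. *)
Definition C1_on (A : set 'rV[R]_m) (f : 'rV[R]_m -> R) : Prop :=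
  exists g : 'I_m -> 'rV[R]_m -> R,
    (forall i, {within A, continuous (g i)}) /\
    forall x, A x ->
      (fun y => f y - f x - \sum_(i < m) g i x * (y ord0 i - x ord0 i))
        =o_ (within A (nbhs x)) (fun y => y - x).

End cantor.

(* Borel sigma-algebra and Lebesgue measure on R^n; the measure is the n-fold
   product of [lebesgue_measure], transported along (x, v) |-> row_mx x v. *)
Section rV_lebesgue.
Context {R : realType}.

Definition rV_coord n (i : 'I_n) (v : 'rV[R]_n) : measurableTypeR R := v ord0 i.

Let rV_set0 n : g_sigma_preimage (@rV_coord n) set0.
Proof. exact: sigma_algebra0. Qed.

Let rV_setC n A :
  g_sigma_preimage (@rV_coord n) A -> g_sigma_preimage (@rV_coord n) (~` A).
Proof. exact: sigma_algebraC. Qed.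

Let rV_bigcup n (F : (set 'rV[R]_n)^nat) :
  (forall i, g_sigma_preimage (@rV_coord n) (F i)) ->
  g_sigma_preimage (@rV_coord n) (\bigcup_i F i).
Proof. exact: sigma_algebra_bigcup. Qed.

HB.instance Definition _ n := @isMeasurable.Build
  (measure_tuple_display default_measure_display)
  'rV[R]_n (g_sigma_preimage (@rV_coord n))
  (@rV_set0 n) (@rV_setC n) (@rV_bigcup n).

Lemma measurable_rVP d (T : measurableType d) n (f : T -> 'rV[R]_n) :
  (forall i, measurable_fun setT (rV_coord i \o f)) -> measurable_fun setT f.
Proof.
move=> mf _ B mB; rewrite setTI.
have : g_sigma_preimage (fun i => @rV_coord n i \o f) (f @^-1` B).
  by rewrite g_sigma_preimage_comp; exists B => //; rewrite setTI.
apply: smallest_sub; first exact: sigma_algebra_measurable.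
case: n => [|n] in f mf B mB *; first by rewrite big_ord0.
rewrite -bigcup_mkord_ord; apply: bigcup_sub => i Ii.
by move=> A [C mC <-]; exact: mf.
Qed.

Lemma measurable_rV_coord n (i : 'I_n) : measurable_fun setT (@rV_coord n i).
Proof.
move=> _ Y mY; rewrite setTI; apply: sub_sigma_algebra => /=.
rewrite -bigcup_seq/=; exists i => /=; first by rewrite mem_index_enum.
by exists Y => //; rewrite setTI.
Qed.

Definition cons_rV n (p : measurableTypeR R * 'rV[R]_n) : 'rV[R]_n.+1 :=
  row_mx (p.1)%:M p.2 : 'rV[R]_(1 + n).

Definition uncons_rV n (v : 'rV[R]_n.+1) : measurableTypeR R * 'rV[R]_n :=
  (v ord0 ord0, \row_i v ord0 (lift ord0 i)).

Lemma cons_rV0 n p : @cons_rV n p ord0 ord0 = p.1.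
Proof.
have -> : ord0 = lshift n ord0 :> 'I_(1 + n) by apply/val_inj.
by rewrite /cons_rV (row_mxEl p.1%:M) mxE eqxx.
Qed.

Lemma cons_rVS n p i : @cons_rV n p ord0 (lift ord0 i) = p.2 ord0 i.
Proof.
have -> : lift ord0 i = rshift 1 i :> 'I_(1 + n) by apply/val_inj.
by rewrite /cons_rV (row_mxEr p.1%:M).
Qed.

Lemma cons_rVK n : cancel (@cons_rV n) (@uncons_rV n).
Proof.
move=> p; rewrite /uncons_rV cons_rV0 [RHS]surjective_pairing; congr pair.
by apply/rowP => i; rewrite mxE cons_rVS.
Qed.

Lemma uncons_rVK n : cancel (@uncons_rV n) (@cons_rV n).
Proof.
move=> v; apply/rowP => i; case: (unliftP ord0 i) => [j ->|->].
  by rewrite cons_rVS mxE.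
by rewrite cons_rV0.
Qed.

Lemma measurable_cons_rV n : measurable_fun setT (@cons_rV n).
Proof.
apply: measurable_rVP => i; case: (unliftP ord0 i) => [j ->|->].
- rewrite (_ : _ \o _ = rV_coord j \o snd).
    by apply: measurableT_comp => //; exact: measurable_rV_coord.
  by apply/funext => p; exact: cons_rVS.
- rewrite (_ : _ \o _ = fst); first exact: measurable_fst.
  by apply/funext => p; exact: cons_rV0.
Qed.

Lemma measurable_uncons_rV n : measurable_fun setT (@uncons_rV n).
Proof.
apply/measurable_fun_pair => /=; first exact: (@measurable_rV_coord n.+1 ord0).
apply: measurable_rVP => i.
rewrite (_ : _ \o _ = rV_coord (lift ord0 i)); first exact: measurable_rV_coord.
by apply/funext => v; rewrite /rV_coord/= mxE.
Qed.

Fixpoint lebesgue_rV n : set 'rV[R]_n -> \bar R :=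
  if n is n'.+1 then
    pushforward (lebesgue_measure \x lebesgue_rV (n := n'))%E (@cons_rV n')
  else \d_(0 : 'rV[R]_0).

Arguments lebesgue_rV : clear implicits.

Section cons_measure.
Variables (n : nat) (mu : {sigma_finite_measure set 'rV[R]_n -> \bar R}).
Local Open Scope ereal_scope.

Let nu := pushforward (@lebesgue_measure R \x mu) (@cons_rV n).

Let nu0 : nu set0 = 0.
Proof. by rewrite /nu /pushforward preimage_set0 measure0. Qed.

Let nu_ge0 A : 0 <= nu A.
Proof. by rewrite /nu /pushforward; exact: measure_ge0. Qed.

Let nu_sigma_additive : semi_sigma_additive nu.
Proof.
have mc (A : set 'rV[R]_n.+1) : measurable A -> measurable (@cons_rV n @^-1` A).
  by move=> mA; rewrite -[X in measurable X]setTI; exact: measurable_cons_rV.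
move=> F mF tF mUF; rewrite /nu /pushforward preimage_bigcup.
apply: measure_semi_sigma_additive => //.
- by move=> k; exact: mc.
- apply/trivIsetP => /= i j _ _ ij; rewrite -preimage_setI.
  by move/trivIsetP : tF => /(_ _ _ _ _ ij) ->//; rewrite preimage_set0.
- by rewrite -preimage_bigcup; exact: mc.
Qed.

HB.instance Definition _ := isMeasure.Build _ _ _ nu
  nu0 nu_ge0 nu_sigma_additive.

Let nu_sigma_finite : sigma_finite setT nu.
Proof.
have /sigma_finiteP[F [FT ndF Foo]] := sigma_finiteT (@lebesgue_measure R).
have /sigma_finiteP[G [GT ndG Goo]] := sigma_finiteT mu.
exists (fun k => @uncons_rV n @^-1` (F k `*` G k)).
  apply/esym; rewrite -subTset => v _.
  have [i _ Fi] : (\bigcup_i F i) (uncons_rV v).1 by rewrite -FT.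
  have [j _ Gj] : (\bigcup_i G i) (uncons_rV v).2 by rewrite -GT.
  exists (maxn i j) => //; split.
    by move: Fi; exact/subsetPset/ndF/leq_maxl.
  by move: Gj; exact/subsetPset/ndG/leq_maxr.
move=> k; have [mFk Fkoo] := Foo k; have [mGk Gkoo] := Goo k; split.
  rewrite -[X in measurable X]setTI; apply: measurable_uncons_rV => //.
  exact: measurableX.
rewrite /nu /pushforward -comp_preimage (_ : _ \o _ = id); last first.
  by apply/funext; exact: cons_rVK.
by rewrite preimage_id product_measure1E// lte_mul_pinfty// ge0_fin_numE.
Qed.

HB.instance Definition _ := Measure_isSigmaFinite.Build _ _ _ nu
  nu_sigma_finite.

Lemma cons_sigma_finite_measure :
  exists mu' : {sigma_finite_measure set 'rV[R]_n.+1 -> \bar R},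
    pushforward (@lebesgue_measure R \x mu) (@cons_rV n) = mu'.
Proof. by exists nu. Qed.

End cons_measure.

Let lebesgue_rV_ex n :
  exists mu : {sigma_finite_measure set 'rV[R]_n -> \bar R},
    lebesgue_rV n = mu :> (set 'rV[R]_n -> \bar R).
Proof.
elim: n => [|n [mu muE]]; first by exists \d_(0 : 'rV[R]_0).
by rewrite /= muE; exact: cons_sigma_finite_measure.
Qed.

Let lebesgue_rV0 n : lebesgue_rV n set0 = 0%E.
Proof. by have [mu ->] := lebesgue_rV_ex n. Qed.

Let lebesgue_rV_ge0 n A : (0 <= lebesgue_rV n A)%E.
Proof. by have [mu ->] := lebesgue_rV_ex n. Qed.

Let lebesgue_rV_sigma_additive n : semi_sigma_additive (lebesgue_rV n).
Proof.
by have [mu ->] := lebesgue_rV_ex n; exact: measure_semi_sigma_additive.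
Qed.

HB.instance Definition _ n := isMeasure.Build _ _ _ (lebesgue_rV n)
  (lebesgue_rV0 n) (@lebesgue_rV_ge0 n) (@lebesgue_rV_sigma_additive n).

Let lebesgue_rV_sigma_finite n : sigma_finite setT (lebesgue_rV n).
Proof. by have [mu ->] := lebesgue_rV_ex n; exact: sigma_finiteT. Qed.

HB.instance Definition _ n := Measure_isSigmaFinite.Build _ _ _ (lebesgue_rV n)
  (@lebesgue_rV_sigma_finite n).

Lemma lebesgue_rV_box n (A : 'I_n -> set R) :
  (forall i, measurable (A i : set (measurableTypeR R))) ->
  lebesgue_rV n [set v | forall i, A i (v ord0 i)] =
    (\prod_(i < n) lebesgue_measure (A i))%E.
Proof.
elim: n A => [|n IHn] A mA.
  by rewrite big_ord0 /= diracE mem_set// => -[].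
rewrite big_ord_recl/= /pushforward.
rewrite (_ : _ @^-1` _ =
    A ord0 `*` [set v : 'rV[R]_n | forall i, A (lift ord0 i) (v ord0 i)]).
  rewrite product_measure1E//=.
    by congr (_ * _)%E; apply: (IHn (fun i => A (lift ord0 i))) => i; exact: mA.
  rewrite (_ : mkset _ =
    \bigcap_(i in [set: 'I_n]) (@rV_coord n i @^-1` A (lift ord0 i))).
    apply: fin_bigcap_measurable; first exact: finite_finset.
    move=> i _; rewrite -[X in measurable X]setTI.
    by apply: measurable_rV_coord => //; exact: mA.
  by apply/seteqP; split => v /= h i; [move=> _; exact: h|exact: (h i Logic.I)].
apply/seteqP; split => [[x v]/= h|[x v]/= [A0 h] i].
  split; first by have := h ord0; rewrite cons_rV0.
  by move=> i; have := h (lift ord0 i); rewrite cons_rVS.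
case: (unliftP ord0 i) => [j ->|->]; first by rewrite cons_rVS.
by rewrite cons_rV0.
Qed.

End rV_lebesgue.
Arguments lebesgue_rV {R} n.

(* Main.v *)
Require Import Defs.
From mathcomp Require Import all_boot all_order all_algebra.
From mathcomp Require Import all_classical all_reals all_analysis.
From mathcomp Require Import measurable_realfun.
From mathcomp Require Import ring lra.

(** It suffices to let the first ratio [L ord0 ord0] vary, the others being
    fixed.  With [c k] the modulus of the [k]-th ratio at a base parameter and
    [b] below the dimension of the Cantor set there, [\sum_k c k `^ b >= 1], and
    Bernoulli weights proportional to [c k `^ b] give a cylinder of diameter [r]
    a mass at most [r `^ b].  On [K], an exponent [a] below its dimension gives
    measures for which balls of radius [r] have mass [O(r `^ a)]
    ([discrete_frostman]).  The two exponents can be chosen with [a + b > 1]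
    ([dimension_exponents]).

    Two points of the Cantor set whose codes have a longest common prefix with
    ratio product [P] differ by [P * g], where [g] stays away from [0] because
    the images of the generating maps are disjoint, and [g] is Lipschitz in the
    parameter.  If every code starts with [N] copies of the letter [ord0], the
    logarithmic derivative of [P] in the first ratio is at least [N] in
    modulus; for [N] large it dominates the variation of [g], so
    [x - y + P * g] moves with speed at least [|P|], up to a constant
    ([expanding]).  Hence the parameters of a segment for which two points of
    the sum set are [r]-close have length [O(r / |P|)], and there are none unless
    [|x - y| <= r + |P|].

    Integrating the number of [r]-close pairs over the parameters and dividing
    by [r] therefore gives at most a multiple of the sum, over pairs of words,
    of the weights times [P `^ a / P].  Near the base parameter this sum is
    dominated by a geometric series since [a + b > 1] ([sum_prefix_prod],
    [energy_integral]).  By Fatou's lemma the energy of almost every parameter is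
    bounded along a sequence of scales ([ae_frequently_bounded]); by
    Cauchy-Schwarz a bounded energy at scale [r] bounds from below the measure of
    the [2 r]-neighbourhood of the sum set ([measure_ge_of_energy]), and the sum
    set is compact.  This is the conclusion near one parameter
    ([positive_measure_locally]), and countably many such neighbourhoods cover
    the box.

    All measures on [K] and on the Cantor set are finitely supported, one for
    each scale; the only limits are those of the energies, in Fatou's lemma, and
    of the measures of shrinking neighbourhoods. *)

Set Implicit Arguments.
Unset Strict Implicit.
Unset Printing Implicit Defensive.

Import Order.TTheory GRing.Theory Num.Theory.
Import numFieldNormedType.Exports.

Local Open Scope classical_set_scope.
Local Open Scope ring_scope.

(** * Finite covers and Hausdorff dimension *)

Lemma powR_lt1 {R : realType} (x e : R) : 0 <= x < 1 -> 0 < e -> x `^ e < 1.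
Proof.
move=> /andP[x0 x1] e0; have -> : 1 = 1 `^ e by rewrite powR1.
by apply: gt0_ltr_powR => //; rewrite nnegrE.
Qed.

Section finite_covers.
Context {R : realType}.
Implicit Types (A : set R) (a b : R) (s : seq (set R * R)).

(** A bound on the diameter travels with each set, instead of the diameter: it
    is real even for the empty set, and scales exactly under contractions. *)
Definition finite_cover A s :=
  (forall p, p \in s ->
    0 <= p.2 /\ forall x y, p.1 x -> p.1 y -> `|x - y| <= p.2) /\
  forall x, A x -> exists2 p, p \in s & p.1 x.

Definition cover_cost b s : R := \sum_(p <- s) p.2 `^ b.

Lemma diam_pow_ge0 b (U : set R) : (0 <= diam_pow b U)%E.
Proof. by rewrite /diam_pow; case: ifP => // _; exact: poweR_ge0. Qed.

Lemma diam_pow_le b (U : set R) l : 0 <= b -> 0 <= l ->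
  (forall x y, U x -> U y -> `|x - y| <= l) -> (diam_pow b U <= (l `^ b)%:E)%E.
Proof.
move=> b0 l0 Ul; rewrite /diam_pow; case: ifPn => [_|/set0P[x Ux]].
  by rewrite lee_fin powR_ge0.
have dl : (diam U <= l%:E)%E.
  by apply: ge_ereal_sup => _ [y Uy [z Uz <-]]; rewrite lee_fin Ul.
have d0 : (0 <= diam U)%E.
  by apply: ereal_sup_ubound; exists x => //; exists x => //; rewrite subrr normr0.
by rewrite -poweR_EFin; apply: gt0_ler_poweR;
  rewrite // in_itv/= ?leey ?d0 ?lee_fin ?l0.
Qed.

Lemma hausdorff_premeasure_finite_cover b delta A s : 0 <= b -> 0 <= delta ->
  finite_cover A s -> (forall p, p \in s -> p.2 <= delta) ->
  (hausdorff_premeasure b delta A <= (cover_cost b s)%:E)%E.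
Proof.
move=> b0 delta0 [sl As] sd.
pose U k := (nth (set0, 0) s k).1.
have Usl k : (size s <= k)%N -> U k = set0 by move=> sk; rewrite /U nth_default.
apply: (@le_trans _ _ (\sum_(0 <= k <oo) diam_pow b (U k))%E).
  apply: ereal_inf_lbound; exists U => //; split.
    move=> x /As[p ps px]; exists (index p s) => //.
    by rewrite /U nth_index.
  move=> k; have [/Usl ->|ks] := leqP (size s) k.
    by apply: ge_ereal_sup => _ [y []].
  have /sl[_ Ul] := mem_nth (set0, 0) ks.
  apply: ge_ereal_sup => _ [y Uy [z Uz <-]]; rewrite lee_fin.
  exact: le_trans (Ul _ _ Uy Uz) (sd _ (mem_nth _ ks)).
rewrite (nneseries_split 0 (size s)); last by move=> k _; exact: diam_pow_ge0.
rewrite [X in (_ + X)%E]eseries0 ?adde0; last first.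
  by move=> k + _; rewrite add0n => /Usl ->; rewrite /diam_pow eqxx.
rewrite add0n /cover_cost (big_nth (set0, 0)) -sumEFin big_nat [leRHS]big_nat.
apply: lee_sum => k /andP[_ ks].
by have [? ?] := sl _ (mem_nth (set0, 0) ks); exact: diam_pow_le.
Qed.

(** A small cost already forces a small mesh: a member of diameter bound at least
    [delta] costs at least [delta `^ b]. *)
Lemma hausdorff_measure_eq0 b A : 0 < b ->
  (forall e, 0 < e -> exists2 s, finite_cover A s & cover_cost b s < e) ->
  hausdorff_measure b A = 0%E.
Proof.
move=> b0 small; apply/eqP; rewrite eq_le; apply/andP; split.
- apply: ge_ereal_sup => _ [delta /= delta0 <-].
  apply/lee_addgt0Pr => e e0; rewrite add0e.
  have [|s cs lts] := small (Num.min e (delta `^ b)).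
    by rewrite lt_min e0 powR_gt0.
  move: lts; rewrite lt_min => /andP[se sd].
  apply: (@le_trans _ _ (cover_cost b s)%:E); last by rewrite lee_fin ltW.
  apply: hausdorff_premeasure_finite_cover => //; try exact: ltW.
  move=> p ps; have [p0 _] := cs.1 _ ps; rewrite leNgt; apply/negP => dp.
  have : delta `^ b < p.2 `^ b.
    by apply: gt0_ltr_powR => //; rewrite nnegrE// ltW.
  apply/negP; rewrite -leNgt; apply: le_trans (ltW sd).
  by rewrite /cover_cost (big_rem p)//= lerDl; apply: sumr_ge0 => q _; exact: powR_ge0.
- apply: (@le_trans _ _ (hausdorff_premeasure b 1 A)).
    apply: le_ereal_inf_tmp => _ [U _ <-].
    by apply: nneseries_ge0 => k _ _; exact: diam_pow_ge0.
  by apply: ereal_sup_ubound; exists 1 => /=.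
Qed.

(** This positive lower bound on the cost of covers is what a Frostman measure
    distributes. *)
Lemma content_gt0 b A : 0 < b -> hausdorff_measure b A <> 0%E ->
  exists2 c, 0 < c & forall s, finite_cover A s -> c <= cover_cost b s.
Proof.
move=> b0 HA; apply: contrapT => /forall2NP noc; apply: HA.
apply: hausdorff_measure_eq0 => // e e0.
have [//|] := noc e; move=> /existsNP[s /not_implyP[cs /negP]].
by rewrite -ltNge => lte; exists s.
Qed.

(** Iterating the inclusions covers [A] by images of [X 0] under the
    compositions of [n] maps, at a cost [(\sum_k c k `^ b) ^+ n * D `^ b]. *)
Lemma self_covering_null m (c : 'I_m -> R) (phi : 'I_m -> R -> R)
    (X : nat -> set R) A D b :
  0 < b -> 0 <= D -> (forall k, 0 <= c k) ->
  (forall k x y, `|phi k x - phi k y| <= c k * `|x - y|) ->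
  (forall x y, X 0 x -> X 0 y -> `|x - y| <= D) ->
  (forall n, X n.+1 `<=` \bigcup_(k in [set: 'I_m]) (phi k @` X n)) ->
  (forall n, A `<=` X n) ->
  \sum_k c k `^ b < 1 -> hausdorff_measure b A = 0%E.
Proof.
move=> b0 D0 c0 phic XD XS AX sum1.
have sum0 : 0 <= \sum_k c k `^ b by apply: sumr_ge0 => k _; exact: powR_ge0.
have cov n : exists2 s, finite_cover (X n) s &
    cover_cost b s = (\sum_k c k `^ b) ^+ n * D `^ b.
  elim: n => [|n [s [sl Xs] cs]].
    exists [:: (X 0, D)]; last by rewrite /cover_cost big_seq1 expr0 mul1r.
    split=> [p|x Xx]; first by rewrite inE => /eqP -> /=.
    by exists (X 0, D) => //; rewrite inE.
  exists [seq (phi k @` p.1, c k * p.2) | k <- enum 'I_m, p <- s].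
    split=> [_ /allpairsP[[k p] /= [_ ps ->]]/=|_ /XS[k _ [x /Xs[p ps px] <-]]].
      have [p0 pl] := sl _ ps; split; first by rewrite mulr_ge0.
      move=> _ _ [x px <-] [y py <-]; apply: le_trans (phic _ _ _) _.
      by rewrite ler_wpM2l// pl.
    exists (phi k @` p.1, c k * p.2); last by exists x.
    by apply/allpairsP; exists (k, p); rewrite mem_enum.
  rewrite exprS -mulrA -cs /cover_cost big_allpairs_dep/= big_enum/=.
  rewrite mulr_suml; apply: eq_bigr => k _; rewrite mulr_sumr.
  rewrite big_seq [RHS]big_seq; apply: eq_bigr => p ps.
  by rewrite powRM//; have [] := sl _ ps.
apply: hausdorff_measure_eq0 => // e e0.
have : (\sum_k c k `^ b) ^+ n * D `^ b @[n --> \oo] --> 0 * D `^ b.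
  by apply: cvgMl; apply: cvg_expr; rewrite ger0_norm.
rewrite mul0r => /cvgr0Pnorm_lt /(_ e e0)[N _ /(_ N (leqnn N))] /= lte.
have [s [sl Xs] cs] := cov N; exists s.
  by split=> // x /(AX N); exact: Xs.
by rewrite cs (le_lt_trans (ler_norm _)).
Qed.

Lemma hausdorff_dim_ge0 A : (0 <= hausdorff_dim A)%E.
Proof. by apply: le_ereal_inf_tmp => _ [s [s0 _] <-]; rewrite lee_fin. Qed.

Lemma hausdorff_dim_le b A : 0 <= b -> hausdorff_measure b A = 0%E ->
  (hausdorff_dim A <= b%:E)%E.
Proof. by move=> b0 Hb; apply: ereal_inf_lbound; exists b. Qed.

Lemma hausdorff_dim_le1 A (M : R) : 0 <= M -> A `<=` `[- M, M] ->
  (hausdorff_dim A <= 1%:E)%E.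
Proof.
move=> M0 AM; apply/lee_addgt0Pr => e e0.
rewrite -EFinD; apply: hausdorff_dim_le; first by rewrite addr_ge0// ltW.
(* An interval is the union of two copies of itself with ratio 1/2. *)
pose phi (k : 'I_2) (x : R) := x / 2 + (if k == ord0 then - M / 2 else M / 2).
apply: (@self_covering_null 2 (fun=> 2^-1) phi (fun=> `[- M, M]%classic) A (2 * M)).
- by lra.
- by lra.
- by move=> k; rewrite invr_ge0.
- move=> k x y; rewrite /phi opprD addrACA subrr addr0 -mulrBl normrM mulrC.
  by rewrite (@ger0_norm _ 2^-1)// invr_ge0.
- move=> x y /=; rewrite !in_itv/= => /andP[? ?] /andP[? ?].
  by rewrite ler_norml; apply/andP; split; lra.
- move=> _ x /=; rewrite in_itv/= => /andP[Mx xM].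
  have [x0|x0] := leP x 0.
    exists ord0 => //; exists (2 * x + M); last by rewrite /phi eqxx; field.
    by rewrite /= in_itv/=; apply/andP; split; lra.
  exists ord_max => //; exists (2 * x - M); last by rewrite /phi/=; field.
  by rewrite /= in_itv/=; apply/andP; split; lra.
- by [].
- rewrite big_const_ord/= addr0 powRD; last first.
    by apply/implyP => _; rewrite invr_eq0 pnatr_eq0.
  rewrite powRr1 ?invr_ge0//.
  have : (2^-1 : R) `^ e < 1 by apply: powR_lt1 => //; lra.
  lra.
Qed.

End finite_covers.

(** * A discrete Frostman lemma *)

Section discrete_frostman.
Context {R : realType}.
Implicit Types (K : set R) (a h y r : R) (s : seq (R * R)) (P Q : pred R).

(** A list of pairs (point, weight) stands for a finitely supported measure. *)
Definition mass s P : R := \sum_(p <- s | P p.1) p.2.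

Lemma mass_cat s1 s2 P : mass (s1 ++ s2) P = mass s1 P + mass s2 P.
Proof. exact: big_cat. Qed.

Lemma le_mass s P Q : (forall p, p \in s -> 0 <= p.2) ->
  (forall p, p \in s -> P p.1 -> Q p.1) -> mass s P <= mass s Q.
Proof.
move=> s0 PQ; rewrite /mass [leLHS]big_mkcond [leRHS]big_mkcond/=.
rewrite big_seq [leRHS]big_seq; apply: ler_sum => p ps.
have := PQ _ ps; case: ifP => _; case: ifP => // _; last by rewrite s0.
by move=> /(_ isT).
Qed.

Lemma mass_ge0 s P : (forall p, p \in s -> 0 <= p.2) -> 0 <= mass s P.
Proof.
by move=> s0; rewrite /mass big_seq_cond; apply: sumr_ge0 => p /andP[/s0].
Qed.

Lemma mass0 s P : (forall p, p \in s -> ~~ P p.1) -> mass s P = 0.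
Proof.
move=> sP; rewrite /mass big_seq_cond big1// => p /andP[/sP/negbTE -> //].
Qed.

Lemma mass_scale c s P :
  mass [seq (p.1, c * p.2) | p <- s] P = c * mass s P.
Proof. by rewrite /mass big_map/= mulr_sumr. Qed.

Lemma le_maxpow a r x y : 0 <= a -> 0 < r -> x <= y ->
  Num.max x r `^ a <= Num.max y r `^ a.
Proof.
move=> a0 r0 xy; apply: ge0_ler_powR => //.
- by rewrite nnegrE le_max (ltW r0) orbT.
- by rewrite nnegrE le_max (ltW r0) orbT.
- by rewrite ge_max !le_max xy lexx orbT.
Qed.

Lemma le_pow2_maxpow a h r x : 0 <= a -> 0 <= h -> h <= 2 * Num.max x r ->
  h `^ a <= 2 `^ a * Num.max x r `^ a.
Proof.
move=> a0 h0 hx; have m0 : 0 <= Num.max x r by lra.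
by rewrite -powRM//; apply: ge0_ler_powR => //; rewrite nnegrE// mulr_ge0.
Qed.

(** Maximal flow equals minimal cut on the binary tree of dyadic subintervals.
    The halves are treated recursively; if the union carries more than
    [h `^ a], it is scaled down to [h `^ a], and [[y, y + h)] alone becomes the
    cut.  The bounds on initial and final segments feed the one on arbitrary
    intervals: an interval that straddles the midpoint is a final segment of the
    left half followed by an initial segment of the right half. *)
Lemma frostman_tree K a N h y : 0 < a -> 0 < h ->
  exists s, [/\ forall p, p \in s -> [/\ K p.1, y <= p.1 < y + h & 0 <= p.2],
    mass s predT <= h `^ a,
    [/\ forall v, mass s (fun x => x < v) <=
          2 `^ a * Num.max (v - y) (h / 2 ^+ N) `^ a,
        forall u, mass s (fun x => u <= x) <=
          2 `^ a * Num.max (y + h - u) (h / 2 ^+ N) `^ a &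
        forall u v, mass s (fun x => u <= x < v) <=
          2 * (2 `^ a * Num.max (v - u) (h / 2 ^+ N) `^ a)] &
    exists2 t, finite_cover (K `&` [set x | y <= x < y + h]) t &
      cover_cost a t <= mass s predT].
Proof.
move=> a0; have a0' := ltW a0; elim: N h y => [|N IH] h y h0.
  have hE x : h `^ a <= 2 `^ a * Num.max x (h / 2 ^+ 0) `^ a.
    apply: le_pow2_maxpow => //; first exact: ltW.
    have : h / 2 ^+ 0 <= Num.max x (h / 2 ^+ 0) by rewrite le_max lexx orbT.
    by rewrite expr0 divr1; lra.
  have hE2 x : h `^ a <= 2 * (2 `^ a * Num.max x (h / 2 ^+ 0) `^ a).
    by have := hE x; have := powR_ge0 h a; lra.
  have [[x [Kx /= xh]]|noK] := pselect (exists x, K x /\ y <= x < y + h); last first.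
    exists [::]; rewrite /mass big_nil; split => //.
    - exact: powR_ge0.
    - split=> *; rewrite big_nil ?mulr_ge0 ?powR_ge0//.
    - exists [::]; last by rewrite /cover_cost big_nil.
      by split=> // x [Kx xh]; case: noK; exists x.
  exists [:: (x, h `^ a)].
  have m1 P : mass [:: (x, h `^ a)] P <= h `^ a.
    by rewrite /mass big_cons big_nil/=; case: ifP; rewrite ?addr0 ?powR_ge0.
  split => //.
  - by move=> p; rewrite inE => /eqP ->; split=> //; exact: powR_ge0.
  - by split=> *; apply: le_trans (m1 _) _.
  exists [:: ([set x | y <= x < y + h], h)].
    split=> [p|z [_ zh]]; last by eexists; [rewrite inE|].
    rewrite inE => /eqP -> /=; split; first exact: ltW.
    by move=> u v /andP[? ?] /andP[? ?]; rewrite ler_norml; apply/andP; split; lra.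
  by rewrite /cover_cost /mass !big_cons !big_nil/=.
have h20 : 0 < h / 2 by lra.
have rE : h / 2 ^+ N.+1 = h / 2 / 2 ^+ N by rewrite exprS invfM mulrA.
set r := h / 2 ^+ N.+1 in rE *.
have r0 : 0 < r by rewrite divr_gt0// exprn_gt0.
have [s1 [s1K _ [pre1 suf1 gen1] [t1 ct1 c1]]] := IH (h / 2) y h20.
have [s2 [s2K _ [pre2 suf2 gen2] [t2 ct2 c2]]] := IH (h / 2) (y + h / 2) h20.
rewrite -rE in pre1 suf1 gen1 pre2 suf2 gen2.
have s0ge p : p \in s1 ++ s2 -> 0 <= p.2.
  by rewrite mem_cat => /orP[/s1K[]|/s2K[]].
have tcov : finite_cover (K `&` [set x | y <= x < y + h]) (t1 ++ t2).
  split=> [p|x [Kx /= /andP[yx xh]]].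
    by rewrite mem_cat => /orP[/ct1.1|/ct2.1].
  have [xm|mx] := ltP x (y + h / 2).
    have [|p pt px] := ct1.2 x; first by split=> //=; rewrite yx xm.
    by exists p => //; rewrite mem_cat pt.
  have [|p pt px] := ct2.2 x; first by split=> //=; rewrite mx/= -addrA -splitr.
  by exists p => //; rewrite mem_cat pt orbT.
have tcost : cover_cost a (t1 ++ t2) <= mass (s1 ++ s2) predT.
  by rewrite mass_cat /cover_cost big_cat lerD.
(* The saturation step: cap the total mass at [h `^ a]. *)
have [s [sK smass stot scov]] : exists s,
    [/\ forall p, p \in s -> [/\ K p.1, y <= p.1 < y + h & 0 <= p.2],
        forall P, mass s P <= mass (s1 ++ s2) P, mass s predT <= h `^ a &
        exists2 t, finite_cover (K `&` [set x | y <= x < y + h]) t &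
          cover_cost a t <= mass s predT].
  have sK p : p \in s1 ++ s2 -> [/\ K p.1, y <= p.1 < y + h & 0 <= p.2].
    rewrite mem_cat => /orP[/s1K|/s2K] [? /andP[? ?] ?]; split=> //.
      by apply/andP; split; lra.
    by apply/andP; split; lra.
  have [le|gt] := leP (mass (s1 ++ s2) predT) (h `^ a).
    by exists (s1 ++ s2); split => //; exists (t1 ++ t2).
  have ha0 : 0 < h `^ a by exact: powR_gt0.
  have T0 : 0 < mass (s1 ++ s2) predT by exact: lt_trans gt.
  have g1 : h `^ a / mass (s1 ++ s2) predT <= 1 by rewrite ler_pdivrMr// mul1r ltW.
  have g0 : 0 <= h `^ a / mass (s1 ++ s2) predT by rewrite divr_ge0 ?ltW.
  exists [seq (p.1, h `^ a / mass (s1 ++ s2) predT * p.2) | p <- s1 ++ s2].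
  have TE : mass [seq (p.1, h `^ a / mass (s1 ++ s2) predT * p.2) | p <- s1 ++ s2]
      predT = h `^ a.
    by rewrite mass_scale divfK// gt_eqF.
  split => //.
  - move=> _ /mapP[p /sK[? ? ?] ->]/=; split=> //; exact: mulr_ge0.
  - move=> P; rewrite mass_scale ler_piMl//; exact: mass_ge0.
  - by rewrite TE.
  exists [:: ([set x | y <= x < y + h], h)].
    split=> [p|z [_ zh]]; last by eexists; [rewrite inE|].
    rewrite inE => /eqP -> /=; split; first exact: ltW.
    by move=> u v /andP[? ?] /andP[? ?]; rewrite ler_norml; apply/andP; split; lra.
  by rewrite /cover_cost TE !big_cons !big_nil/= addr0.
exists s.
have sge p : p \in s -> 0 <= p.2 by move=> /sK[].
have stot' P : mass s P <= h `^ a.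
  by apply: le_trans stot; exact: le_mass.
split=> //; split.
- move=> v; have [vm|mv] := leP v (y + h / 2).
    apply: le_trans (smass _) _; rewrite mass_cat [X in _ + X]mass0 ?addr0//.
    by move=> p /s2K[_ /andP[? ?] _]; rewrite -leNgt; lra.
  apply: le_trans (stot' _) _; apply: le_pow2_maxpow => //; first exact: ltW.
  have : v - y <= Num.max (v - y) r by rewrite le_max lexx.
  lra.
- move=> u; have [um|mu] := leP (y + h / 2) u.
    apply: le_trans (smass _) _; rewrite mass_cat [X in X + _]mass0 ?add0r//.
      apply: le_trans (suf2 _) _; rewrite ler_wpM2l ?powR_ge0// le_maxpow//; lra.
    by move=> p /s1K[_ /andP[? ?] _]; rewrite -ltNge; lra.
  apply: le_trans (stot' _) _; apply: le_pow2_maxpow => //; first exact: ltW.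
  have : y + h - u <= Num.max (y + h - u) r by rewrite le_max lexx.
  lra.
- move=> u v; have [vm|mv] := leP v (y + h / 2).
    apply: le_trans (smass _) _; rewrite mass_cat [X in _ + X]mass0 ?addr0//.
    move=> p /s2K[_ /andP[? ?] _]; rewrite negb_and -!leNgt -ltNge.
    by apply/orP; right; lra.
  have [um|mu] := leP (y + h / 2) u.
    apply: le_trans (smass _) _; rewrite mass_cat [X in X + _]mass0 ?add0r//.
    by move=> p /s1K[_ /andP[? ?] _]; rewrite negb_and -ltNge; apply/orP; left; lra.
  apply: le_trans (smass _) _; rewrite mass_cat mulr2n mulrDl !mul1r; apply: lerD.
    apply: (@le_trans _ _ (mass s1 (fun x => u <= x))).
      by apply: le_mass => [p /s1K[]//|p _ /andP[]].
    apply: le_trans (suf1 _) _; rewrite ler_wpM2l ?powR_ge0// le_maxpow//; lra.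
  apply: (@le_trans _ _ (mass s2 (fun x => x < v))).
    by apply: le_mass => [p /s2K[]//|p _ /andP[]].
  apply: le_trans (pre2 _) _; rewrite ler_wpM2l ?powR_ge0// le_maxpow//; lra.
Qed.

(** The cut of [frostman_tree] covers [K], so the total mass is at least the
    content [c]; normalising costs a factor [c^-1]. *)
Lemma discrete_frostman K a (M : R) : 0 < a -> 0 <= M -> K `<=` `[- M, M] ->
  hausdorff_measure a K <> 0%E ->
  exists2 C, 0 < C & forall r, 0 < r -> exists s,
    [/\ forall p, p \in s -> K p.1 /\ 0 <= p.2, mass s predT = 1 &
        forall z rho, r <= rho ->
          mass s (fun x => `|x - z| <= rho) <= C * rho `^ a].
Proof.
move=> a0 M0 KM /(content_gt0 a0)[c c0 cK].
have P0 (x : R) : 0 < x -> 0 < x `^ a by exact: powR_gt0.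
exists (2 * 2 `^ a * 3 `^ a / c).
  by rewrite divr_gt0// mulr_gt0// ?P0// mulr_gt0// P0.
move=> r r0; pose h := 2 * M + 1.
have h0 : 0 < h by rewrite /h; lra.
have [N hN] : exists N, h / 2 ^+ N <= r.
  have : h * (2^-1 : R) ^+ n @[n --> \oo] --> h * 0.
    by apply: cvgMr; apply: cvg_expr; rewrite ger0_norm ?invr_ge0//; lra.
  rewrite mulr0 => /cvgr0Pnorm_lt /(_ r r0)[N _ /(_ N (leqnn N))] /= lth.
  by exists N; rewrite -exprVn ltW// (le_lt_trans (ler_norm _)).
have [s [sK _ [_ _ gen] [t tcov tcost]]] := frostman_tree K N (- M) a0 h0.
have Kh : K `&` [set x | - M <= x < - M + h] = K.
  apply: setIidl => x /KM /=; rewrite in_itv/= => /andP[? ?].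
  by apply/andP; split => //; rewrite /h; lra.
rewrite Kh in tcov; have cT := le_trans (cK _ tcov) tcost.
have T0 : 0 < mass s predT by exact: lt_le_trans cT.
have Ti0 : 0 <= (mass s predT)^-1 by rewrite invr_ge0 ltW.
exists [seq (p.1, (mass s predT)^-1 * p.2) | p <- s]; split.
- by move=> _ /mapP[p /sK[? _ ?] ->]/=; split=> //; exact: mulr_ge0.
- by rewrite mass_scale mulVf// gt_eqF.
move=> z rho rrho; rewrite mass_scale mulrC.
have rho0 : 0 < rho by exact: lt_le_trans rrho.
rewrite [leRHS]mulrAC; apply: ler_pM => //; last by rewrite lef_pV2.
  by apply: mass_ge0 => p /sK[].
(* A closed ball of radius [rho] lies in a half-open interval of length [3 * rho]. *)
apply: (@le_trans _ _ (mass s (fun x => z - rho <= x < z + 2 * rho))).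
  apply: le_mass => [p /sK[]//|p _].
  by rewrite ler_distl => /andP[? ?]; apply/andP; split; lra.
apply: le_trans (gen _ _) _; rewrite -!mulrA ler_wpM2l// ler_wpM2l ?powR_ge0//.
rewrite -powRM ?(ltW rho0)//; apply: ge0_ler_powR; first exact: ltW.
- by rewrite nnegrE ltW// lt_max divr_gt0 ?exprn_gt0// orbT.
- by rewrite nnegrE mulr_ge0// ltW.
- by rewrite ge_max; apply/andP; split; lra.
Qed.

End discrete_frostman.

(** * From energy to measure *)

Section energy_and_measure.
Context {R : realType}.
Implicit Types (A : set R) (r e : R).

Definition thickening e A : set R := \bigcup_(x in A) ball x e.

Lemma open_thickening e A : 0 < e -> open (thickening e A).
Proof. by move=> e0; apply: bigcup_open => x _; exact: ball_open. Qed.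

Lemma measurable_thickening e A : 0 < e ->
  measurable (thickening e A : set (measurableTypeR R)).
Proof. by move=> /open_thickening -/(_ A); exact: open_measurable. Qed.

Let cell r (i : int) : set R := [set x | Num.floor (x / r) = i].

Let cellE r i : 0 < r -> cell r i = `[i%:~R * r, (i + 1)%:~R * r[%classic.
Proof.
move=> r0; apply/seteqP; split => x /=.
  move=> <-; rewrite in_itv/= -ler_pdivlMr// -ltr_pdivrMr//.
  by rewrite floor_le floorD1_gt.
rewrite in_itv/= -ler_pdivlMr// -ltr_pdivrMr// => h.
exact: floor_def.
Qed.

Let measurable_cell r i : 0 < r ->
  measurable (cell r i : set (measurableTypeR R)).
Proof. by move=> r0; rewrite cellE. Qed.

Let measure_cell r i : 0 < r -> lebesgue_measure (cell r i) = r%:E.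
Proof.
move=> r0; rewrite cellE// lebesgue_measure_itv/= lte_fin ltr_pM2r// ltr_int.
rewrite ltrDl ltr01 -EFinB -mulrBl intrD; congr (_%:E); ring.
Qed.

Let measure_cells r (L : seq int) : 0 < r -> uniq L ->
  lebesgue_measure (\big[setU/set0]_(i <- L) cell r i) = ((size L)%:R * r)%:E.
Proof.
move=> r0; elim: L => [|i L IH] /=; first by rewrite big_nil measure0 mul0r.
move=> /andP[iL uL]; rewrite big_cons measureU//=.
- by rewrite measure_cell// IH// -EFinD -natr1 mulrDl mul1r addrC.
- exact: measurable_cell.
- by apply: bigsetU_measurable => j _; exact: measurable_cell.
- rewrite -subset0 => x [/= xi]; rewrite -bigcup_seq => -[j /= jL xj].
  by move: iL; rewrite -xi xj jL.
Qed.

(** Cut the line into cells of length [r], with masses [q i].  Points of one cell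
    are closer than [r], so [\sum_i q i ^+ 2 <= M * r] while [\sum_i q i = 1], and
    by Cauchy-Schwarz at least [(M * r)^-1] cells carry mass.  Each of them lies
    within [2 * r] of [A]. *)
Lemma measure_ge_of_energy r M A (s : seq (R * R)) : 0 < r -> 0 < M ->
  (forall p, p \in s -> 0 <= p.2) -> mass s predT = 1 ->
  (forall p, p \in s -> exists2 x, A x & `|p.1 - x| <= r) ->
  \sum_(p <- s) \sum_(q <- s | `|p.1 - q.1| < r) p.2 * q.2 <= M * r ->
  (M^-1%:E <= lebesgue_measure (thickening (2 * r) A))%E.
Proof.
move=> r0 M0 s0 s1 sA sE.
pose fl (p : R * R) : int := Num.floor (p.1 / r).
pose L := undup [seq fl p | p <- s].
have uL : uniq L by exact: undup_uniq.
have sL p : p \in s -> fl p \in L by move=> ps; rewrite mem_undup map_f.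
pose q i := \sum_(p <- s | fl p == i) p.2.
have fiber (F : R * R -> R) :
    \sum_(i <- L) \sum_(p <- s | fl p == i) F p = \sum_(p <- s) F p.
  under eq_bigr do rewrite big_mkcond/=.
  rewrite exchange_big/= big_seq [RHS]big_seq; apply: eq_bigr => p /sL pL.
  rewrite (bigD1_seq (fl p))//= eqxx big1 ?addr0// => i /negbTE.
  by rewrite eq_sym => ->.
have q1 : \sum_(i <- L) q i = 1 by rewrite fiber; exact: s1.
have q2 : \sum_(i <- L) q i ^+ 2 <= M * r.
  apply: le_trans sE.
  rewrite -[leRHS]fiber; apply: ler_sum => i _.
  rewrite expr2 mulr_suml; rewrite big_seq_cond [leRHS]big_seq_cond.
  apply: ler_sum => p /andP[ps /eqP pi]; rewrite mulr_sumr.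
  rewrite big_mkcond/= [leRHS]big_mkcond/= big_seq [leRHS]big_seq.
  apply: ler_sum => p' ps'; case: eqP => [p'i|_]; last first.
    by case: ifP => // _; rewrite mulr_ge0// s0.
  rewrite ifT//; have : cell r i p.1 by exact: pi.
  have : cell r i p'.1 by exact: p'i.
  rewrite cellE//= !in_itv/= intrD => /andP[? ?] /andP[? ?].
  by rewrite ltr_norml; apply/andP; split; lra.
have size_ge : M^-1 <= (size L)%:R * r.
  (* Cauchy-Schwarz in the form [2 * t * q - t ^+ 2 * q ^+ 2 <= 1], with
     [t = (M * r)^-1]. *)
  have : \sum_(i <- L) (2 * (M * r)^-1 * q i - (M * r)^-1 ^+ 2 * q i ^+ 2) <= (size L)%:R.
    rewrite -sum1_size natr_sum; apply: ler_sum => i _.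
    set t := (M * r)^-1; have := sqr_ge0 (t * q i - 1).
    have -> : (t * q i - 1) ^+ 2 = t ^+ 2 * q i ^+ 2 - 2 * t * q i + 1 by ring.
    lra.
  rewrite big_split/= sumrN -!mulr_sumr q1 mulr1 => le.
  have Mr0 : 0 < M * r by rewrite mulr_gt0.
  have : (M * r)^-1 ^+ 2 * \sum_(i <- L) q i ^+ 2 <= (M * r)^-1.
    rewrite expr2 -mulrA ger_pMr ?invr_gt0//.
    by rewrite ler_pdivrMl// mulr1.
  move=> le2; have {le le2} : (M * r)^-1 <= (size L)%:R by lra.
  rewrite invfM => le; apply: le_trans (ler_wpM2r (ltW r0) le).
  by rewrite -mulrA mulVf ?gt_eqF// mulr1.
apply: (@le_trans _ _ (lebesgue_measure (\big[setU/set0]_(i <- L) cell r i))).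
  by rewrite measure_cells// lee_fin.
apply: le_measure; rewrite ?inE.
- by apply: bigsetU_measurable => i _; exact: measurable_cell.
- by apply: measurable_thickening; rewrite mulr_gt0.
- rewrite -bigcup_seq => z [i /= ]; rewrite mem_undup => /mapP[p ps ip].
  have [x Ax px] := sA _ ps => zi; exists x => //.
  have : cell r i p.1 by rewrite ip.
  move: zi; rewrite cellE//= !in_itv/= intrD => /andP[? ?] /andP[? ?].
  rewrite /ball/=; move: px; rewrite ler_norml ltr_norml => /andP[? ?].
  by apply/andP; split; lra.
Qed.

Lemma compact_measure_ge c A : compact A ->
  (forall e, 0 < e -> (c%:E <= lebesgue_measure (thickening e A))%E) ->
  (c%:E <= lebesgue_measure A)%E.
Proof.
move=> cA Ac; pose F (n : nat) : set (measurableTypeR R) := thickening n.+1%:R^-1 A.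
have n0 (n : nat) : 0 < n.+1%:R^-1 :> R by rewrite invr_gt0.
have FA : \bigcap_n F n = A.
  apply/seteqP; split=> [x Fx|x Ax n _]; last first.
    by exists x => //; exact: ballxx.
  apply: (compact_closed (@Rhausdorff R) cA) => B /nbhs_ballP[e /= e0 eB].
  have [n ne] : exists n, n.+1%:R^-1 < e.
    by have [N _ /(_ N (leqnn N)) lt] := near_infty_natSinv_lt (PosNum e0); exists N.
  have [y Ay /ball_sym yx] := Fx n Logic.I.
  by exists y; split=> //; apply: eB; apply: le_ball yx; exact: ltW.
have : lebesgue_measure \o F @ \oo --> lebesgue_measure A.
  rewrite -FA; apply: nonincreasing_cvg_mu.
  - have [M [_ MA]] := compact_bounded cA.
    have MA' := MA (M + 1) ltac:(lra).
    apply: (@le_lt_trans _ _ (lebesgue_measure `[- (M + 2), M + 2]%classic)).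
      apply: le_measure; rewrite ?inE//; first exact: measurable_thickening.
      move=> x [y /MA' /=]; rewrite /ball/= invr1 ler_norml ltr_norml in_itv/=.
      by move=> /andP[? ?] /andP[? ?]; apply/andP; split; lra.
    by rewrite lebesgue_measure_itv/=; case: ifP => _; rewrite ?ltry.
  - by move=> n; exact: measurable_thickening.
  - by rewrite FA; exact: compact_measurable.
  - apply/nonincreasing_seqP => n; apply/subsetPset => x [y Ay yx].
    exists y => //; apply: le_ball yx.
    by rewrite lef_pV2 ?posrE// ler_nat.
move=> cv; rewrite -(cvg_lim _ cv)//; apply: lime_ge.
  by apply/cvg_ex; eexists; exact: cv.
by apply: nearW => n; exact: Ac.
Qed.

End energy_and_measure.

(** * Lebesgue measure on row vectors *)

Section row_vectors.
Context {R : realType}.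

Definition cube n (v : 'rV[R]_n) (e : R) : set 'rV[R]_n :=
  [set w | forall i, `|w ord0 i - v ord0 i| < e].

(** A countable base of the topology, used both for the measurability of open
    sets and to pass from local to global null sets. *)
Definition rational_cube n (c : 'rV[rat]_n * nat) : set 'rV[R]_n :=
  cube (map_mx ratr c.1) c.2.+1%:R^-1.

Lemma rational_cube_basis n (v : 'rV[R]_n) e : 0 < e ->
  exists2 c, rational_cube c v & rational_cube c `<=` cube v e.
Proof.
move=> e0; have [k ke] : exists k : nat, k.+1%:R^-1 < e / 2.
  have e20 : 0 < e / 2 by rewrite divr_gt0.
  by have [N _ /(_ N (leqnn N)) lt] := near_infty_natSinv_lt (PosNum e20); exists N.
have k0 : 0 < k.+1%:R^-1 :> R by rewrite invr_gt0.
set dk : R := k.+1%:R^-1 in ke k0.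
have rat_near (x : R) : exists q : rat, `|x - ratr q| < dk.
  have [|q] := @rat_in_itvoo R (x - dk) (x + dk); first by lra.
  rewrite in_itv/= => /andP[? ?]; exists q.
  by rewrite ltr_norml; apply/andP; split; lra.
pose q i := sval (cid (rat_near (v ord0 i))).
exists (\row_i q i, k) => [i|w wc i].
  by rewrite /= !mxE; exact: (svalP (cid (rat_near (v ord0 i)))).
have := wc i; rewrite /= !mxE -/dk => w1.
have := svalP (cid (rat_near (v ord0 i))); rewrite -/(q i) distrC => w2.
have := ler_distD (ratr (q i)) (w ord0 i) (v ord0 i).
lra.
Qed.

Lemma measurable_rV_prod n (A : 'I_n -> set R) :
  (forall i, measurable (A i : set (measurableTypeR R))) ->
  measurable [set v : 'rV[R]_n | forall i, A i (v ord0 i)].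
Proof.
move=> mA; rewrite (_ : mkset _ = \bigcap_(i in [set: 'I_n]) (@rV_coord R n i @^-1` A i)).
  apply: fin_bigcap_measurable; first exact: finite_finset.
  move=> i _; rewrite -[X in measurable X]setTI.
  by apply: measurable_rV_coord => //; exact: mA.
by apply/seteqP; split => w /= h i; [move=> _; exact: h|exact: (h i Logic.I)].
Qed.

Lemma measurable_cube n (v : 'rV[R]_n) e : measurable (cube v e).
Proof.
apply: (measurable_rV_prod (A := fun i => [set x | `|x - v ord0 i| < e])) => i.
rewrite (_ : mkset _ = ball (v ord0 i) e); first exact: measurable_ball.
by apply/seteqP; split => x; rewrite /ball/= distrC.
Qed.

Lemma measurable_box n (J : 'I_n -> interval R) : measurable (box J).
Proof.
by apply: (measurable_rV_prod (A := fun i => [set` J i])) => i; exact: measurable_itv.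
Qed.

Lemma nbhs_cube n (v : 'rV[R]_n) (U : set 'rV[R]_n) :
  nbhs v U <-> exists2 e, 0 < e & cube v e `<=` U.
Proof.
split=> [/nbhs_ballP[e /= e0 eU]|[e e0 eU]].
  exists e => // w wc; apply: eU; split=> // i j.
  by rewrite ord1 /ball/= distrC; exact: wc.
apply/nbhs_ballP; exists e => // w wb; apply: eU => i.
by have := wb.2 ord0 i; rewrite /ball/= distrC.
Qed.

Lemma open_measurable_rV n (U : set 'rV[R]_n) : open U -> measurable U.
Proof.
move=> oU.
rewrite (_ : U = \bigcup_(c : 'rV[rat]_n * nat)
    (if `[< rational_cube c `<=` U >] then rational_cube c else set0)).
  apply: countable_bigcupT_measurable => // c.
  by case: ifP => // _; exact: measurable_cube.
apply/seteqP; split => [v Uv|v [c _]]; last by case: asboolP => // cU; exact: cU.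
have [e e0 eU] : exists2 e, 0 < e & cube v e `<=` U.
  by apply/nbhs_cube; exact: open_nbhs_nbhs.
have [c cv ce] := rational_cube_basis v e0.
by exists c => //; rewrite asboolT//; exact: subset_trans eU.
Qed.

Lemma measurable_fun_within_continuous n (A : set 'rV[R]_n) (f : 'rV[R]_n -> R) :
  measurable A -> {within A, continuous f} ->
  measurable_fun A (f : _ -> measurableTypeR R).
Proof.
move=> mA /continuousP cf; apply: (measurability _ (RGenOpens.measurableE R)).
move=> _ [_ [a [b ->] <-]].
have oI : open [set x : R^o | x \in `]a, b[] by exact: interval_open.
have /open_subspaceP[V oV VA] := cf _ oI.
rewrite setIC -VA; apply: measurableI => //; exact: open_measurable_rV.
Qed.

Lemma negligible_locally n (mu : {measure set 'rV[R]_n -> \bar R}) N :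
  (forall v, N v -> exists2 e, 0 < e & mu.-negligible (N `&` cube v e)) ->
  mu.-negligible N.
Proof.
move=> locN.
pose F (k : nat) : set 'rV[R]_n := if unpickle k is Some c then
  if `[< mu.-negligible (N `&` @rational_cube n c) >] then N `&` rational_cube c
  else set0 else set0.
have Fneg k : mu.-negligible (F k).
  rewrite /F; case: unpickle => [c|]; last exact: negligible_set0.
  by case: asboolP => // _; exact: negligible_set0.
apply: negligibleS (negligible_bigcup Fneg) => v Nv.
have [e e0 Ne] := locN _ Nv; have [c cv ce] := rational_cube_basis v e0.
exists (pickle c) => //; rewrite /F pickleK asboolT//.
by apply: negligibleS Ne; exact: setIS.
Qed.

(** Fubini with the first coordinate integrated first: the section of [A] above
    each [v] lies in an interval of length [2 * s], and [v] ranges over a cube. *)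
Lemma lebesgue_rV_slices n (A : set 'rV[R]_n.+1) (c : 'rV[R]_n.+1) (rho s : R) :
  measurable A -> 0 <= rho -> 0 <= s ->
  A `<=` [set v | forall i, `|v ord0 i - c ord0 i| <= rho] ->
  (forall t t' v, A (cons_rV (t, v)) -> A (cons_rV (t', v)) -> `|t - t'| <= s) ->
  (lebesgue_rV n.+1 A <= (2 * s * (2 * rho) ^+ n)%:E)%E.
Proof.
move=> mA rho0 s0 Ac As.
have mcA : measurable (@cons_rV R n @^-1` A).
  by rewrite -[X in measurable X]setTI; exact: measurable_cons_rV.
rewrite /= /pushforward.
rewrite (product_measure_unique
  (m' := (lebesgue_measure \x^ lebesgue_rV n)%E))//; last first.
  by move=> B B' mB mB' /=; rewrite product_measure2E.
pose B (i : 'I_n) : set R :=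
  `[c ord0 (lift ord0 i) - rho, c ord0 (lift ord0 i) + rho]%classic.
pose Q := [set v : 'rV[R]_n | forall i, B i (v ord0 i)].
have mQ : measurable Q by apply: measurable_rV_prod => i; exact: measurable_itv.
have Qmu : lebesgue_rV n Q = ((2 * rho) ^+ n)%:E.
  transitivity (\prod_(i < n) lebesgue_measure (B i))%E.
    by apply: lebesgue_rV_box => i; exact: measurable_itv.
  rewrite (eq_bigr (fun=> (2 * rho)%:E)); last first.
    move=> i _; rewrite /B lebesgue_measure_itv/= lte_fin; case: ifPn => [_|].
      by rewrite -EFinB; congr (_%:E); ring.
    rewrite -leNgt => h; have -> : rho = 0 by lra.
    by rewrite mulr0.
  by rewrite prodEFin big_const_ord iter_mulr_1.
apply: (@le_trans _ _ (\int[lebesgue_rV n]_(v in setT) ((2 * s)%:E * (\1_Q v)%:E))%E).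
  apply: ge0_le_integral => //.
  - exact: measurable_fun_ysection.
  - apply: measurable_funeM; apply/measurable_EFinP; exact: measurable_indic.
  move=> v _ /=.
  have [[t At]|noA] := pselect (exists t, A (cons_rV (t, v))); last first.
    rewrite (_ : ysection _ _ = set0); last first.
      rewrite -subset0 => t; rewrite /ysection/= inE => h; apply: noA; by exists t.
    by rewrite measure0 mule_ge0// lee_fin ?mulr_ge0.
  have Qv : Q v.
    move=> i; have := Ac _ At (lift ord0 i); rewrite cons_rVS /B/= in_itv/=.
    by rewrite ler_norml => /andP[? ?]; apply/andP; split; lra.
  rewrite indicE mem_set//= mule1.
  apply: (@le_trans _ _ (lebesgue_measure `[t - s, t + s]%classic)).
    apply: le_measure; rewrite ?inE.
    - exact: measurable_ysection.
    - exact: measurable_itv.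
    move=> t'; rewrite /ysection/= inE => At'.
    have := As _ _ _ At At'; rewrite ler_norml in_itv/= => /andP[? ?].
    by apply/andP; split; lra.
  rewrite lebesgue_measure_itv/=; case: ifP => _; last by rewrite lee_fin mulr_ge0.
  by rewrite -EFinB lee_fin; lra.
have m1Q : measurable_fun setT (fun v => (\1_Q v : R)%:E).
  by apply/measurable_EFinP; exact: measurable_indic.
rewrite (ge0_integralZl_EFin _ _ _ m1Q) ?mulr_ge0//.
rewrite integral_indic// setIT [X in (_ * X)%E](_ : _ = ((2 * rho) ^+ n)%:E)//.
Qed.

End row_vectors.

Section fatou_bound.
Context d (T : measurableType d) (R : realType).

(** By Fatou's lemma the lower limit of [E] is integrable, hence finite almost
    everywhere. *)
Lemma ae_frequently_bounded (mu : {measure set T -> \bar R}) (D : set T)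
    (E : nat -> T -> R) (C : R) : measurable D ->
  (forall n, measurable_fun D (E n)) -> (forall n x, D x -> 0 <= E n x) ->
  (forall n, (\int[mu]_(x in D) (E n x)%:E <= C%:E)%E) ->
  {ae mu, forall x, D x -> exists2 M, 0 < M &
    forall N, exists2 n, (N <= n)%N & E n x <= M}.
Proof.
move=> mD mE E0 EC.
have mEE n : measurable_fun D (EFin \o E n) by apply/measurable_EFinP.
pose L x := limn_einf (fun n => (E n x)%:E).
have mL : measurable_fun D L.
  apply: measurableT_comp => //; apply: measurable_fun_limn_esup => n.
  by apply: measurableT_comp => //; exact: mEE.
have L0 x : D x -> (0 <= L x)%E.
  move=> Dx; rewrite /L limn_einf_lim; apply: lime_ge; first exact: is_cvg_einfs.
  by apply: nearW => n; apply: le_ereal_inf_tmp => _ [k _ <-]; rewrite lee_fin E0.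
have intL : (\int[mu]_(x in D) L x <= C%:E)%E.
  apply: le_trans (fatou mu mD mEE _) _; first by move=> n x Dx; rewrite lee_fin E0.
  rewrite limn_einf_lim; apply: lime_le; first exact: is_cvg_einfs.
  apply: nearW => n; apply: ge_ereal_inf; eexists; last exact: (EC n).
  by exists n => //=.
have iL : mu.-integrable D L.
  apply/integrableP; split => //; rewrite (eq_integral L).
    by apply: le_lt_trans intL _; rewrite ltry.
  by move=> x; rewrite inE => Dx; rewrite gee0_abs// L0.
apply: filterS (integrable_ae mD iL) => x Lfin Dx.
have /fineK LE := Lfin Dx.
exists (fine (L x) + 1); first by rewrite ltr_wpDl// fine_ge0// L0.
move=> N; apply: contrapT => noN.
have : ((fine (L x) + 1)%:E <= L x)%E.
  rewrite {2}/L limn_einf_lim; apply: lime_ge; first exact: is_cvg_einfs.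
  exists N => // n /= Nn; apply: le_ereal_inf_tmp => _ [k /= nk <-].
  rewrite lee_fin leNgt; apply/negP => lt; apply: noN.
  by exists k; [exact: leq_trans nk|exact: ltW].
by rewrite -LE lee_fin; lra.
Qed.

End fatou_bound.

(** * Words and common prefixes *)

Section words.
Context {R : realType} {m : nat}.
Implicit Types (p c : 'I_m -> R) (w v : seq 'I_m).

Fixpoint words n : seq (seq 'I_m) :=
  if n is n'.+1 then [seq i :: w | i <- enum 'I_m, w <- words n'] else [:: [::]].

Lemma size_words n w : w \in words n -> size w = n.
Proof.
elim: n w => [|n IH] w /=; first by rewrite inE => /eqP ->.
by move=> /allpairsP[[i v] /= [_ /IH <- ->]].
Qed.

Definition word_weight p w : R := \prod_(i <- w) p i.

Lemma word_weight_ge0 p w : (forall i, 0 <= p i) -> 0 <= word_weight p w.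
Proof. by move=> p0; exact: prodr_ge0. Qed.

Lemma sum_words_cons n (F : seq 'I_m -> R) :
  \sum_(w <- words n.+1) F w = \sum_i \sum_(w <- words n) F (i :: w).
Proof. by rewrite /= big_allpairs_dep/= big_enum. Qed.

Lemma sum_word_weight n p : \sum_i p i = 1 ->
  \sum_(w <- words n) word_weight p w = 1.
Proof.
move=> p1; elim: n => [|n IH]; first by rewrite big_seq1 /word_weight big_nil.
rewrite sum_words_cons -[RHS]p1; apply: eq_bigr => i _.
rewrite -[RHS]mulr1 -IH mulr_sumr; apply: eq_bigr => w _.
by rewrite /word_weight big_cons.
Qed.

(** For the moduli of the contraction ratios this is the size of the smallest
    cylinder that contains both words. *)
Fixpoint prefix_prod c w v : R :=
  match w, v with
  | i :: w', j :: v' => if i == j then c i * prefix_prod c w' v' else 1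
  | _, _ => 1
  end.

Lemma prefix_prod_gt0 c w v : (forall i, 0 < c i) -> 0 < prefix_prod c w v.
Proof.
move=> c0; elim: w v => [|i w IH] [|j v]//=.
by case: eqP => // _; rewrite mulr_gt0.
Qed.

Lemma prefix_prod_norm c w v : `|prefix_prod c w v| = prefix_prod (fun i => `|c i|) w v.
Proof.
elim: w v => [|i w IH] [|j v]/=; rewrite ?normr1//.
by case: eqP => _; rewrite ?normr1// normrM IH.
Qed.

Lemma prefix_prod_ge0 c w v : (forall i, 0 <= c i) -> 0 <= prefix_prod c w v.
Proof.
move=> c0; elim: w v => [|i w IH] [|j v]//=.
by case: eqP => // _; rewrite mulr_ge0.
Qed.

Lemma le_prefix_prod c c' w v : (forall i, 0 <= c i <= c' i) ->
  prefix_prod c w v <= prefix_prod c' w v.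
Proof.
move=> cc; have c0 i : 0 <= c i by have /andP[] := cc i.
elim: w v => [|i w IH] [|j v]//=; case: eqP => // _.
by have /andP[? ?] := cc i; rewrite ler_pM// prefix_prod_ge0.
Qed.

Lemma prefix_prod_diag c theta w : (forall i, 0 <= c i <= theta) ->
  prefix_prod c w w <= theta ^+ size w.
Proof.
move=> ct; have c0 i : 0 <= c i by have /andP[] := ct i.
elim: w => [|i w IH] /=; first by rewrite expr0.
by have /andP[? ?] := ct i; rewrite eqxx exprS ler_pM// prefix_prod_ge0.
Qed.

Lemma prefix_prod_powR a c c' w v : (forall i, 0 < c i) -> (forall i, 0 < c' i) ->
  prefix_prod (fun i => c i `^ a / c' i) w v =
  prefix_prod c w v `^ a / prefix_prod c' w v.
Proof.
move=> c0 c'0; elim: w v => [|i w IH] [|j v]/=; rewrite ?powR1 ?divr1//.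
case: eqP => _; rewrite ?powR1 ?divr1// IH powRM ?ltW ?prefix_prod_gt0//.
by rewrite invfM mulrACA.
Qed.

(** Split according to the first letters.  Pairs that agree there contribute at
    most [kappa] times the sum for shorter words, because [p i * b i <= kappa];
    the other pairs contribute at most their probability.  So the sums [S] obey
    [S' <= 1 + kappa * S], and [(1 - kappa)^-1] is the fixed point. *)
Lemma sum_prefix_prod kappa n p b : 0 <= kappa < 1 -> (forall i, 0 <= p i) ->
  \sum_i p i = 1 -> (forall i, 0 <= b i) -> (forall i, p i * b i <= kappa) ->
  \sum_(w <- words n) \sum_(v <- words n)
    word_weight p w * word_weight p v * prefix_prod b w v <= (1 - kappa)^-1.
Proof.
move=> /andP[k0 k1] p0 p1 b0 pb; have k1' : 0 < 1 - kappa by rewrite subr_gt0.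
elim: n => [|n IH].
  rewrite !big_seq1 /word_weight big_nil/= !mulr1 -[leLHS]invr1 lef_pV2 ?posrE//.
  by rewrite lerBlDr lerDl.
set S := \sum_(w <- words n) _ in IH.
have S0 : 0 <= S.
  apply: sumr_ge0 => w _; apply: sumr_ge0 => v _.
  by rewrite !mulr_ge0 ?word_weight_ge0 ?prefix_prod_ge0.
have W1 i : \sum_(w <- words n) word_weight p (i :: w) = p i.
  rewrite -[RHS]mulr1 -(sum_word_weight n p1) mulr_sumr; apply: eq_bigr => w _.
  by rewrite /word_weight big_cons.
have step i j : \sum_(w <- words n) \sum_(v <- words n)
    word_weight p (i :: w) * word_weight p (j :: v) * prefix_prod b (i :: w) (j :: v) <=
    p i * p j + (if j == i then p i * kappa * S else 0).
  have [-> | ij] := eqVneq j i.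
    apply: (@le_trans _ _ (p i * (p i * b i) * S)); last first.
      apply: ler_wpDl; first exact: mulr_ge0.
      by rewrite ler_wpM2r// ler_wpM2l.
    rewrite le_eqVlt; apply/orP; left; apply/eqP.
    rewrite mulr_sumr; apply: eq_bigr => w _; rewrite mulr_sumr; apply: eq_bigr => v _.
    by rewrite /= eqxx /word_weight !big_cons; ring.
  rewrite addr0 -(W1 i) -(W1 j) mulr_suml; apply: ler_sum => w _.
  rewrite mulr_sumr; apply: ler_sum => v _ /=.
  by rewrite eq_sym (negbTE ij) mulr1.
have -> : \sum_(w <- words n.+1) \sum_(v <- words n.+1)
    word_weight p w * word_weight p v * prefix_prod b w v =
  \sum_i \sum_j \sum_(w <- words n) \sum_(v <- words n)
    word_weight p (i :: w) * word_weight p (j :: v) * prefix_prod b (i :: w) (j :: v).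
  rewrite sum_words_cons; apply: eq_bigr => i _.
  under eq_bigr do rewrite sum_words_cons.
  by rewrite exchange_big.
apply: (@le_trans _ _
    (\sum_i \sum_j (p i * p j + (if j == i then p i * kappa * S else 0)))).
  by apply: ler_sum => i _; apply: ler_sum => j _; exact: step.
have -> : \sum_i \sum_j (p i * p j + (if j == i then p i * kappa * S else 0)) =
    1 + kappa * S.
  rewrite -[X in X + _]p1 -[in RHS](mul1r (kappa * S)) -[in RHS]p1 mulr_suml -big_split/=.
  apply: eq_bigr => i _; rewrite big_split/= -mulr_sumr p1 mulr1 -big_mkcond/=.
  by rewrite big_pred1_eq mulrA.
apply: (@le_trans _ _ (1 + kappa * (1 - kappa)^-1)); first by rewrite lerD2l ler_wpM2l.
have -> : 1 + kappa * (1 - kappa)^-1 = (1 - kappa)^-1 by field; rewrite gt_eqF.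
by [].
Qed.

End words.

(** * Transversality in the first contraction ratio *)

Section code_points.
Context {R : realType} {n m : nat} (d : 'I_m -> 'rV[R]_m -> R).
Implicit Types (L : 'rV[R]_m) (w v : seq 'I_m).

Definition code_map L w (x : R) : R := foldr (affine_maps d L) x w.

Lemma code_map_cat L w v x : code_map L (w ++ v) x = code_map L w (code_map L v x).
Proof. exact: foldr_cat. Qed.

Lemma code_mapB L w x y :
  code_map L w x - code_map L w y = word_weight (L ord0) w * (x - y).
Proof.
elim: w => [|i w IH] /=; first by rewrite /word_weight big_nil mul1r.
rewrite /affine_maps /word_weight big_cons -/(word_weight _ w) -mulrA -IH; ring.
Qed.

(** The factor of a difference of code points that does not shrink with the
    common prefix: the difference of the codes with that prefix removed. *)
Fixpoint gap L w v : R :=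
  match w, v with
  | i :: w', j :: v' => if i == j then gap L w' v'
                        else code_map L w 0 - code_map L v 0
  | _, _ => 0
  end.

Lemma code_pointB L w v : size w = size v ->
  code_map L w 0 - code_map L v 0 = prefix_prod (L ord0) w v * gap L w v.
Proof.
elim: w v => [|i w IH] [|j v]//=; first by rewrite subrr mulr0.
move=> [/IH wv]; case: eqP => [<-|_]; last by rewrite mul1r.
by rewrite -mulrA -wv /affine_maps; ring.
Qed.

End code_points.

Lemma ratio_ge1 {R : realFieldType} (x y : R) :
  0 < x * y -> `|x| <= `|y| -> 1 <= y / x.
Proof.
move=> xy le; have x0 : x != 0 by apply: contraTneq xy => ->; rewrite mul0r ltxx.
have -> : y / x = (x * y) / (x * x) by field.
have xx : 0 < x * x by rewrite -expr2 exprn_even_gt0.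
rewrite ler_pdivlMr// mul1r -[leRHS](gtr0_norm xy) -[leLHS](gtr0_norm xx).
by rewrite !normrM ler_wpM2l.
Qed.

Section transversality.
Context {R : realType} {n : nat}.
Let m := n.+1.
Variables (d : 'I_m -> 'rV[R]_m -> R) (B : set 'rV[R]_m).
Variables (l u : 'I_m -> R) (theta delta lip : R).
Hypothesis l_gt0 : forall k, 0 < l k.
Hypothesis theta_lt1 : theta < 1.
Hypothesis u_le : forall k, u k <= theta.
Hypothesis lip_ge0 : 0 <= lip.
Hypothesis delta_gt0 : 0 < delta.
Hypothesis B_ratio : forall L, B L -> forall k, l k <= `|L ord0 k| <= u k.
Hypothesis B_sign : forall L L', B L -> B L' -> 0 < L ord0 ord0 * L' ord0 ord0.
Hypothesis B_unit : forall L, B L -> forall k x, 0 <= x <= 1 ->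
  0 <= affine_maps d L k x <= 1.
Hypothesis B_sep : forall L, B L -> forall i j x y, i != j ->
  0 <= x <= 1 -> 0 <= y <= 1 ->
  delta <= `|affine_maps d L i x - affine_maps d L j y|.
Hypothesis B_lip : forall L L', B L -> B L' ->
  (forall k, k != ord0 -> L ord0 k = L' ord0 k) ->
  forall k, `|d k L - d k L'| <= lip * `|L ord0 ord0 - L' ord0 ord0|.

Lemma code_map_unit L w x : B L -> 0 <= x <= 1 -> 0 <= code_map d L w x <= 1.
Proof. by move=> BL x01; elim: w => //= i w IH; exact: B_unit. Qed.

Let code_point_unit L w : B L -> 0 <= code_map d L w 0 <= 1.
Proof. by move=> BL; apply: code_map_unit; rewrite // lexx ler01. Qed.

Let unit_dist (x y : R) : 0 <= x <= 1 -> 0 <= y <= 1 -> `|x - y| <= 1.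
Proof.
by move=> /andP[? ?] /andP[? ?]; rewrite ler_norml; apply/andP; split; lra.
Qed.

Lemma gap_le1 L w v : B L -> `|gap d L w v| <= 1.
Proof.
move=> BL; elim: w v => [|i w IH] [|j v]/=; rewrite ?normr0 ?ler01//.
case: eqP => // _; apply: unit_dist; exact: (code_point_unit (_ :: _)).
Qed.

Lemma gap_ge L w v : B L -> size w = size v -> w != v -> delta <= `|gap d L w v|.
Proof.
move=> BL; elim: w v => [|i w IH] [|j v]//= [/IH wv].
rewrite eqseq_cons; case: eqP => [_ /= /wv//|/eqP ij _].
by apply: B_sep => //; exact: code_point_unit.
Qed.

(** The Lipschitz constant of every code point in the first ratio. *)
Let Lc : R := (1 + lip) / (1 - theta).

(** [Lc] is the fixed point of [M = theta * M + 1 + lip]: one more letter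
    contracts the variation by [theta], and adds at most [1] for the ratio and
    [lip] for the translation. *)
Lemma code_point_lip L L' w : B L -> B L' ->
  (forall k, k != ord0 -> L ord0 k = L' ord0 k) ->
  `|code_map d L w 0 - code_map d L' w 0| <= Lc * `|L ord0 ord0 - L' ord0 ord0|.
Proof.
move=> BL BL' LL'; set D := `|L ord0 ord0 - L' ord0 ord0|.
have D0 : 0 <= D by exact: normr_ge0.
have t1 : 0 < 1 - theta by rewrite subr_gt0.
have LcE : Lc * (1 - theta) = 1 + lip by rewrite /Lc divfK// gt_eqF.
have Lc0 : 0 <= Lc by apply: divr_ge0; [exact: addr_ge0|exact: ltW].
elim: w => [|i w IH] /=; first by rewrite subrr normr0 mulr_ge0.
set x := code_map d L w 0 in IH *; set y := code_map d L' w 0 in IH *.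
have y1 : `|y| <= 1.
  by have /andP[? ?] := code_point_unit w BL'; rewrite ger0_norm.
rewrite /affine_maps.
have -> : L ord0 i * x + d i L - (L' ord0 i * y + d i L') =
  L ord0 i * (x - y) + (L ord0 i - L' ord0 i) * y + (d i L - d i L') by ring.
apply: le_trans (ler_normD _ _) _.
apply: (@le_trans _ _ (theta * (Lc * D) + D + lip * D)).
  apply: lerD; last exact: B_lip.
  apply: le_trans (ler_normD _ _) _; rewrite !normrM; apply: lerD.
    apply: ler_pM => //; have /andP[_ /le_trans] := B_ratio BL i; exact.
  rewrite -[leRHS]mulr1; apply: ler_pM => //.
  have [->|/LL' ->] := eqVneq i ord0; first exact: lexx.
  by rewrite subrr normr0.
have -> : theta * (Lc * D) + D + lip * D = (theta * Lc + (1 + lip)) * D by ring.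
by rewrite -LcE ler_wpM2r// -[leRHS]mulr1 le_eqVlt; apply/orP; left; apply/eqP; ring.
Qed.

Lemma gap_lip L L' w v : B L -> B L' ->
  (forall k, k != ord0 -> L ord0 k = L' ord0 k) ->
  `|gap d L w v - gap d L' w v| <= 2 * Lc * `|L ord0 ord0 - L' ord0 ord0|.
Proof.
move=> BL BL' LL'.
have P0 : 0 <= 2 * Lc * `|L ord0 ord0 - L' ord0 ord0|.
  rewrite mulr_ge0// mulr_ge0//; apply: divr_ge0; first exact: addr_ge0.
  by rewrite subr_ge0 ltW.
elim: w v => [|i w IH] [|j v];
  rewrite [gap _ _ _ _]/= ?[gap _ L' _ _]/= ?subrr ?normr0//=.
case: eqP => // _; rewrite -!/(code_map _ _ (_ :: _) _).
have -> : forall a b c e : R, a - b - (c - e) = (a - c) - (b - e) by move=> *; ring.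
apply: le_trans (ler_normB _ _) _.
by rewrite -mulrA mulr_natl mulr2n; apply: lerD; exact: (@code_point_lip _ _ (_ :: _)).
Qed.

(** Only the letter [ord0] has a ratio that changes, and its ratio keeps its
    sign, so each occurrence multiplies the product by a factor at least [1]. *)
Lemma prefix_prod_monotone L L' w v : B L -> B L' ->
  (forall k, k != ord0 -> L ord0 k = L' ord0 k) ->
  `|L ord0 ord0| <= `|L' ord0 ord0| ->
  exists2 rho, 1 <= rho & prefix_prod (L' ord0) w v = rho * prefix_prod (L ord0) w v.
Proof.
move=> BL BL' LL' le0; elim: w v => [|i w IH] [|j v]/=; try by exists 1; rewrite ?mulr1.
case: eqP => _; last by exists 1; rewrite ?mulr1.
have [rho rho1 ->] := IH v.
have [->|/LL' <-] := eqVneq i ord0; last by exists rho => //; ring.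
have L0 : 0 < `|L ord0 ord0|.
  by have /andP[/lt_le_trans -> ] := B_ratio BL ord0.
have L0n : L ord0 ord0 != 0 by rewrite -normr_gt0.
exists (L' ord0 ord0 / L ord0 ord0 * rho); last by field.
rewrite mulr_ege1//.
by apply: ratio_ge1 => //; exact: B_sign.
Qed.

Variable N : nat.
Hypothesis N_large : 2 * Lc + 1 <= N%:R * delta.

(** The [N] initial letters [ord0] make the derivative in the first ratio large
    compared with the variation of [gap]. *)
Definition anchored L w := code_map d L (nseq N ord0 ++ w) 0.

Lemma anchoredB L w v : size w = size v ->
  anchored L w - anchored L v =
  L ord0 ord0 ^+ N * prefix_prod (L ord0) w v * gap d L w v.
Proof.
move=> wv; rewrite /anchored !code_map_cat code_mapB code_pointB// -mulrA.
by rewrite /word_weight big_nseq iter_mulr_1.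
Qed.

(** Transversality.  With [s] the relative increase of the first ratio, the product
    over the common prefix, anchor included, grows from [Q] to [rr * Q] where
    [rr >= (1 + s) ^+ N >= 1 + N * s], by Bernoulli's inequality.  The difference
    to estimate is [Q * ((rr - 1) * g' - (g - g'))]: the first term is at least
    [N * delta * D], the second at most [2 * Lc * D], and [N] was chosen
    so that the former exceeds the latter by [D]. *)
Let expanding_wlog L L' w v a : B L -> B L' ->
  (forall k, k != ord0 -> L ord0 k = L' ord0 k) ->
  `|L ord0 ord0| <= `|L' ord0 ord0| ->
  size w = size v -> w != v ->
  l ord0 ^+ N * prefix_prod l w v * `|L ord0 ord0 - L' ord0 ord0| <=
  `|(a + (anchored L w - anchored L v)) - (a + (anchored L' w - anchored L' v))|.
Proof.
move=> BL BL' LL' le0 swv wv; rewrite !anchoredB//.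
have [rho rho1 ->] := prefix_prod_monotone w v BL BL' LL' le0.
set P := prefix_prod (L ord0) w v; set D := `|_ - _|.
have L0 : 0 < `|L ord0 ord0|.
  by have /andP[/lt_le_trans -> ] := B_ratio BL ord0.
have L0n : L ord0 ord0 != 0 by rewrite -normr_gt0.
have L01 : `|L ord0 ord0| <= 1.
  have /andP[_ /le_trans ->//] := B_ratio BL ord0.
  by apply: le_trans (u_le _) (ltW theta_lt1).
pose s := L' ord0 ord0 / L ord0 ord0 - 1.
have L'E : L' ord0 ord0 = (1 + s) * L ord0 ord0 by rewrite /s; field.
have s0 : 0 <= s by rewrite subr_ge0; apply: ratio_ge1 => //; exact: B_sign.
have Ds : D <= s.
  rewrite /D L'E -normrN opprB mulrDl mul1r addrAC subrr add0r normrM ger0_norm//.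
  by rewrite ler_piMr.
pose rr := (1 + s) ^+ N * rho.
have rrN : 1 + N%:R * D <= rr.
  have bern : 1 + N%:R * s <= (1 + s) ^+ N.
    elim: N => [|k IH]; first by rewrite expr0 mul0r addr0.
    rewrite exprS; apply: (@le_trans _ _ ((1 + s) * (1 + k%:R * s))).
      rewrite -natr1. have : 0 <= k%:R * s * s by rewrite !mulr_ge0. by lra.
    by rewrite ler_wpM2l// addr_ge0.
  apply: (@le_trans _ _ ((1 + s) ^+ N)).
    by apply: le_trans bern; rewrite lerD2l ler_wpM2l.
  by rewrite /rr ler_peMr// exprn_ge0// addr_ge0.
set Q := L ord0 ord0 ^+ N * P.
have -> : L' ord0 ord0 ^+ N * (rho * P) = rr * Q by rewrite L'E exprMn /rr /Q; ring.
set g := gap d L w v; set g' := gap d L' w v.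
have -> : a + Q * g - (a + rr * Q * g') = - (Q * ((rr - 1) * g' - (g - g'))) by ring.
rewrite normrN normrM; apply: ler_pM.
- rewrite mulr_ge0 ?exprn_ge0 ?ltW//; exact: prefix_prod_gt0.
- exact: normr_ge0.
- rewrite /Q normrM normrX; apply: ler_pM.
  + by rewrite exprn_ge0// ltW.
  + by rewrite ltW// prefix_prod_gt0.
  + apply: lerXn2r; rewrite ?nnegrE ?(ltW (l_gt0 _))//.
    by have /andP[] := B_ratio BL ord0.
  + rewrite /P prefix_prod_norm; apply: le_prefix_prod => i.
    by rewrite ltW//=; have /andP[] := B_ratio BL i.
apply: le_trans (lerB_dist _ _).
have g1 : delta <= `|g'| by exact: gap_ge.
have g2 : `|g - g'| <= 2 * Lc * D by exact: gap_lip.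
have D0 : 0 <= D by exact: normr_ge0.
rewrite normrM ger0_norm; last first.
  by rewrite subr_ge0; apply: le_trans rrN; rewrite lerDl mulr_ge0.
have : N%:R * D * delta <= (rr - 1) * `|g'|.
  by apply: ler_pM => //; rewrite ?mulr_ge0 ?(ltW delta_gt0)//; lra.
have : (2 * Lc + 1) * D <= N%:R * delta * D by rewrite ler_wpM2r.
lra.
Qed.

Lemma expanding L L' w v a : B L -> B L' ->
  (forall k, k != ord0 -> L ord0 k = L' ord0 k) -> size w = size v -> w != v ->
  l ord0 ^+ N * prefix_prod l w v * `|L ord0 ord0 - L' ord0 ord0| <=
  `|(a + (anchored L w - anchored L v)) - (a + (anchored L' w - anchored L' v))|.
Proof.
move=> BL BL' LL' swv wv; have [le|lt] := leP `|L ord0 ord0| `|L' ord0 ord0|.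
  exact: expanding_wlog.
rewrite distrC [leRHS]distrC; apply: expanding_wlog => //; last exact: ltW.
by move=> k /LL' ->.
Qed.

Lemma anchoredB_le L w v : B L -> size w = size v ->
  `|anchored L w - anchored L v| <= prefix_prod u w v.
Proof.
move=> BL swv; rewrite anchoredB// !normrM normrX -[leRHS]mulr1 -[leRHS]mul1r mulrA.
have u1 k : `|L ord0 k| <= u k by have /andP[] := B_ratio BL k.
apply: ler_pM; rewrite ?mulr_ge0 ?exprn_ge0 ?gap_le1//.
apply: ler_pM; rewrite ?exprn_ge0//.
  rewrite exprn_ile1//; exact: le_trans (u1 _) (le_trans (u_le _) (ltW theta_lt1)).
rewrite prefix_prod_norm; apply: le_prefix_prod => i.
by rewrite normr_ge0 u1.
Qed.

End transversality.

(** * The energy integrated over the parameters *)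

Lemma integral_sum_indic_le d (T : measurableType d) (R : realType)
    (mu : {measure set T -> \bar R}) (D : set T) (I : eqType) (s : seq I)
    (c beta : I -> R) (A : I -> set T) : measurable D ->
  (forall i, i \in s -> [/\ 0 <= c i, measurable (A i), A i `<=` D &
     (mu (A i) <= (beta i)%:E)%E]) ->
  measurable_fun D (fun x => \sum_(i <- s) c i * \1_(A i) x) /\
  (\int[mu]_(x in D) (\sum_(i <- s) c i * \1_(A i) x)%:E <=
    (\sum_(i <- s) c i * beta i)%:E)%E.
Proof.
move=> mD; elim: s => [|i s IH] sP.
  rewrite big_nil; split; first by under eq_fun do rewrite big_nil; exact: measurable_cst.
  by under eq_integral do rewrite big_nil; rewrite integral0.
have [ci mAi AiD mui] := sP i (mem_head _ _).
have [ms is_] := IH (fun j js => sP j (mem_behead (s := i :: s) js)).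
have s0 x : 0 <= \sum_(j <- s) c j * \1_(A j) x.
  rewrite big_seq; apply: sumr_ge0 => j js; rewrite mulr_ge0//.
  by have [] := sP j (mem_behead (s := i :: s) js).
have mi : measurable_fun D (fun x => c i * \1_(A i) x : R).
  by apply: measurable_funM; [exact: measurable_cst|exact: measurable_indic].
split.
  under eq_fun do rewrite big_cons.
  exact: measurable_funD.
under eq_integral do rewrite big_cons EFinD.
rewrite ge0_integralD//; last 4 first.
- by move=> x _; rewrite lee_fin mulr_ge0.
- exact/measurable_EFinP.
- by move=> x _; rewrite lee_fin.
- exact/measurable_EFinP.
rewrite big_cons EFinD leeD//.
under eq_integral do rewrite EFinM.
rewrite ge0_integralZl_EFin//; last first.
  by apply/measurable_EFinP; exact: measurable_indic.
by rewrite integral_indic// setIidl// EFinM lee_wpmul2l.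
Qed.

Section energy.
Context {R : realType} {n m : nat}.
Variables (B : set 'rV[R]_n.+1) (z : seq 'I_m -> 'rV[R]_n.+1 -> R).
Variables (c : 'rV[R]_n.+1) (rho : R).
Variables (l u p : 'I_m -> R) (theta kappa a c0 : R).
Hypothesis mB : measurable B.
Hypothesis rho_gt0 : 0 < rho.
Hypothesis B_bounded : B `<=` [set v | forall i, `|v ord0 i - c ord0 i| <= rho].
Hypothesis lu : forall k, 0 < l k <= u k.
Hypothesis u_theta : forall k, u k <= theta.
Hypothesis theta_01 : 0 < theta < 1.
Hypothesis a_01 : 0 < a <= 1.
Hypothesis p_ge0 : forall k, 0 <= p k.
Hypothesis p_sum : \sum_k p k = 1.
Hypothesis kappa_01 : 0 <= kappa < 1.
Hypothesis pul : forall k, p k * (u k `^ a / l k) <= kappa.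
Hypothesis c0_gt0 : 0 < c0.
Hypothesis z_measurable : forall w, measurable_fun B (z w : _ -> R).
Hypothesis z_close : forall L w v, B L -> size w = size v ->
  `|z w L - z v L| <= prefix_prod u w v.
Hypothesis z_expanding : forall L L' w v x, B L -> B L' ->
  (forall k, k != ord0 -> L ord0 k = L' ord0 k) -> size w = size v -> w != v ->
  c0 * prefix_prod l w v * `|L ord0 ord0 - L' ord0 ord0| <=
  `|(x + (z w L - z v L)) - (x + (z w L' - z v L'))|.

Let U w v := prefix_prod u w v.
Let l_ w v := prefix_prod l w v.

Let l_gt0 k : 0 < l k. Proof. by have /andP[] := lu k. Qed.
Let u_gt0 k : 0 < u k. Proof. by have /andP[/lt_le_trans h /h] := lu k. Qed.
Let U_gt0 w v : 0 < U w v. Proof. exact: prefix_prod_gt0. Qed.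
Let l__gt0 w v : 0 < l_ w v. Proof. exact: prefix_prod_gt0. Qed.

Let lU w v : l_ w v <= U w v.
Proof. by apply: le_prefix_prod => k; have /andP[/ltW -> ->] := lu k. Qed.

(** The parameters for which two points of the sum set, [x + z w] and [y + z v],
    are [r]-close. *)
Definition coincidence (r x y : R) (w v : seq 'I_m) : set 'rV[R]_n.+1 :=
  B `&` [set L | `|(x + z w L) - (y + z v L)| < r].

Lemma measurable_coincidence (r x y : R) w v : measurable (coincidence r x y w v).
Proof.
have mf : measurable_fun B (fun L => `|(x + z w L) - (y + z v L)| : R).
  apply: measurableT_comp => //; apply: measurable_funB.
    by apply: measurable_funD => //; exact: measurable_cst.
  by apply: measurable_funD => //; exact: measurable_cst.
rewrite (_ : coincidence r x y w v =
  B `&` (fun L => `|(x + z w L) - (y + z v L)|) @^-1` `]-oo, r[%classic).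
  by apply: mf => //; exact: measurable_itv.
by apply/seteqP; split => L; rewrite /coincidence/= in_itv.
Qed.

Let mu : {measure set 'rV[R]_n.+1 -> \bar R} := lebesgue_rV n.+1.

Let bounded_coincidence (r x y : R) w v :
  coincidence r x y w v `<=` [set v | forall i, `|v ord0 i - c ord0 i| <= rho].
Proof. by move=> L [/B_bounded]. Qed.

Let cons_eq (t t' : R) (v : 'rV[R]_n) k : k != ord0 ->
  cons_rV (t, v) ord0 k = cons_rV (t', v) ord0 k :> R.
Proof.
by case: (unliftP ord0 k) => [j ->|->]; rewrite ?eqxx// !cons_rVS.
Qed.

Let coincidence_trivial (r x y : R) w v :
  (mu (coincidence r x y w v) <= (2 * (2 * rho) * (2 * rho) ^+ n)%:E)%E.
Proof.
apply: lebesgue_rV_slices; [exact: measurable_coincidence|exact: ltW| |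
  exact: bounded_coincidence|].
  by rewrite mulr_ge0// ltW.
move=> t t' L [/B_bounded/(_ ord0) + _] [/B_bounded/(_ ord0) + _].
rewrite !cons_rV0/= !ler_norml => /andP[? ?] /andP[? ?].
by apply/andP; split; lra.
Qed.

Let coincidence_slices (r x y : R) w v : 0 < r -> size w = size v -> w != v ->
  (mu (coincidence r x y w v) <=
   (2 * (2 * r / (c0 * l_ w v)) * (2 * rho) ^+ n)%:E)%E.
Proof.
move=> r0 swv wv; have cl0 : 0 < c0 * l_ w v by rewrite mulr_gt0.
apply: lebesgue_rV_slices; [exact: measurable_coincidence|exact: ltW| |
  exact: bounded_coincidence|].
  by rewrite divr_ge0 ?mulr_ge0// ltW.
move=> t t' L [BL /= Lr] [BL' /= Lr'].
have := z_expanding (x - y) BL BL' (cons_eq t t' L) swv wv.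
rewrite !cons_rV0/= ler_pdivlMr// mulrC => /le_trans; apply.
apply: le_trans (ler_normB _ _) _.
move: Lr Lr'; rewrite opprD addrACA => Lr; rewrite opprD addrACA => Lr'.
by rewrite mulr_natl mulr2n ltW// ltrD.
Qed.

Let coincidence_far (r x y : R) w v : size w = size v -> r + U w v <= `|x - y| ->
  coincidence r x y w v = set0.
Proof.
move=> swv far; rewrite -subset0 => L [BL /=].
have := z_close BL swv; rewrite -/(U w v) => close lt.
have := ler_normD ((x + z w L) - (y + z v L)) (- (z w L - z v L)).
rewrite normrN (_ : _ - _ + _ = x - y); last by ring.
lra.
Qed.

(** Coincidences happen only for [|x - y| <= 2 * V r w v].  Divided by [r], their
    measure is then at most [H r w v]: the trivial bound is used when the
    cylinder is smaller than [r], in particular for [w = v], and the slices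
    otherwise. *)
Let V (r : R) w v := Num.max r (U w v).
Let H (r : R) w v : R := if U w v <= r then 2 * (2 * rho) * (2 * rho) ^+ n / r
                   else 2 * (2 / (c0 * l_ w v)) * (2 * rho) ^+ n.
Let D0 := 2 * (2 * rho + 2 / c0) * (2 * rho) ^+ n.

Let rhon_ge0 : 0 <= (2 * rho) ^+ n.
Proof. by rewrite exprn_ge0// mulr_ge0// ltW. Qed.

Let H_ge0 (r : R) w v : 0 < r -> 0 <= H r w v.
Proof.
move=> r0; rewrite /H; case: ifP => _.
  by rewrite divr_ge0 ?(ltW r0)// mulr_ge0// !mulr_ge0// ltW.
by rewrite mulr_ge0// mulr_ge0// divr_ge0// ltW// mulr_gt0.
Qed.

Let coincidence_le (r x y : R) w v : 0 < r -> size w = size v -> (w = v -> U w v <= r) ->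
  (mu (coincidence r x y w v) <=
   (r * (H r w v * (`|y - x| <= 2 * V r w v)%R%:R))%:E)%E.
Proof.
move=> r0 swv diag; case: (leP `|y - x| (2 * V r w v)) => [_|far]; last first.
  rewrite coincidence_far ?measure0 ?mulr0//.
  have : r <= V r w v by rewrite le_max lexx.
  have : U w v <= V r w v by rewrite le_max lexx orbT.
  by rewrite distrC in far; lra.
rewrite mulr1 /H; case: ifPn => [_|Ur].
  apply: le_trans (coincidence_trivial _ _ _ _ _) _.
  by rewrite lee_fin [leRHS]mulrCA mulfV ?gt_eqF// mulr1.
have wv : w != v by apply: contraNneq Ur => /diag.
apply: le_trans (coincidence_slices _ _ r0 swv wv) _.
rewrite lee_fin le_eqVlt; apply/orP; left; apply/eqP; ring.
Qed.

(** Both regimes give the same bound.  For a cylinder of size [U <= r] this is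
    [r `^ a / r <= U `^ a / U], which holds because [a <= 1]. *)
Let HV_le (r : R) w v : 0 < r -> H r w v * V r w v `^ a <= D0 * (U w v `^ a / l_ w v).
Proof.
move=> r0; have [a0 a1] := andP a_01.
have U0 := U_gt0 w v; have l0 := l__gt0 w v; have Ul := lU w v.
have UaU : 0 < U w v `^ a by exact: powR_gt0.
have rho2 : 0 <= 2 * rho by rewrite mulr_ge0// ltW.
have ic0 : 0 <= 2 / c0 by rewrite divr_ge0// ltW.
rewrite /H /V; have [Ur|rU] := leP (U w v) r.
  have key : r `^ a / r <= U w v `^ a / l_ w v.
    apply: (@le_trans _ _ (U w v `^ a / U w v)); last first.
      by rewrite ler_wpM2l ?(ltW UaU)// lef_pV2.
    have rU1 : 1 <= r / U w v by rewrite ler_pdivlMr// mul1r.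
    have -> : r `^ a = (r / U w v) `^ a * U w v `^ a.
      rewrite -powRM; [by rewrite divfK// gt_eqF| |exact: ltW].
      by apply: divr_ge0; exact: ltW.
    rewrite mulrAC [leRHS]mulrC; apply: ler_wpM2r; first exact: ltW.
    rewrite ler_pdivrMr// [leRHS]mulrC; exact: (ler1_powR rU1 a1).
  rewrite mulrAC -mulrA; apply: ler_pM => //.
  - exact: mulr_ge0 (mulr_ge0 _ rho2) rhon_ge0.
  - by apply: divr_ge0; [exact: powR_ge0|exact: ltW].
  by rewrite /D0 ler_wpM2r// ler_wpM2l// lerDl.
have -> : 2 * (2 / (c0 * l_ w v)) * (2 * rho) ^+ n * U w v `^ a =
  2 * (2 / c0) * (2 * rho) ^+ n * (U w v `^ a / l_ w v).
  by rewrite invfM; ring.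
rewrite ler_wpM2r//; first by rewrite divr_ge0 ?ltW.
by rewrite /D0 ler_wpM2r// ler_wpM2l// lerDr.
Qed.

Variables (C : R) (C_ge0 : 0 <= C).

Section one_scale.
Variables (r : R) (N : nat) (s : seq (R * R)).
Hypothesis r_gt0 : 0 < r.
Hypothesis theta_r : theta ^+ N <= r.
Hypothesis s_ge0 : forall q, q \in s -> 0 <= q.2.
Hypothesis s_mass : mass s predT = 1.
Hypothesis s_ball : forall x t, r <= t ->
  mass s (fun y => `|y - x| <= t) <= C * t `^ a.

Definition atoms : seq ((R * R) * seq 'I_m) :=
  [seq (q, w) | q <- s, w <- words N].

Definition atom_weight (b : (R * R) * seq 'I_m) : R :=
  b.1.2 * word_weight p b.2.

Definition atom_pos (L : 'rV[R]_n.+1) (b : (R * R) * seq 'I_m) : R :=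
  b.1.1 + z b.2 L.

Lemma mem_atoms b : b \in atoms -> b.1 \in s /\ b.2 \in words N.
Proof. by move=> /allpairsP[[q w] /= [? ? ->]]. Qed.

Lemma atom_weight_ge0 b : b \in atoms -> 0 <= atom_weight b.
Proof.
by move=> /mem_atoms[/s_ge0 ? _]; rewrite mulr_ge0// word_weight_ge0.
Qed.

Lemma sum_atoms (F : (R * R) * seq 'I_m -> R) :
  \sum_(b <- atoms) F b = \sum_(q <- s) \sum_(w <- words N) F (q, w).
Proof. by rewrite /atoms big_allpairs_dep. Qed.

Lemma sum_atom_weight : \sum_(b <- atoms) atom_weight b = 1.
Proof.
rewrite sum_atoms -s_mass; apply: eq_bigr => q _.
by rewrite /atom_weight/= -mulr_sumr sum_word_weight// mulr1.
Qed.

(** The number of [r]-close pairs of atoms, counted with their weights and divided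
    by [r]. *)
Definition energy (L : 'rV[R]_n.+1) : R :=
  r^-1 * \sum_(b <- atoms) \sum_(b' <- atoms)
    atom_weight b * atom_weight b' *
    (`|atom_pos L b - atom_pos L b'| < r)%R%:R.

Let coin (bb : ((R * R) * seq 'I_m) * ((R * R) * seq 'I_m)) :=
  coincidence r bb.1.1.1 bb.2.1.1 bb.1.2 bb.2.2.

Let bound (bb : ((R * R) * seq 'I_m) * ((R * R) * seq 'I_m)) : R :=
  r * (H r bb.1.2 bb.2.2 *
    (`|bb.2.1.1 - bb.1.1.1| <= 2 * V r bb.1.2 bb.2.2)%R%:R).

Let pairs := [seq (b, b') | b <- atoms, b' <- atoms].

Let energyE L : B L -> energy L =
  \sum_(bb <- pairs) r^-1 * (atom_weight bb.1 * atom_weight bb.2) * \1_(coin bb) L.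
Proof.
move=> BL; rewrite /pairs big_allpairs_dep/= /energy mulr_sumr.
apply: eq_bigr => b _; rewrite mulr_sumr; apply: eq_bigr => b' _.
rewrite mulrA; congr (_ * _); rewrite indicE; congr (_%:R : R).
congr nat_of_bool; apply/idP/idP; first by move=> lt; rewrite inE; split.
by rewrite inE => -[].
Qed.

(** For fixed words, summing over the points of [K] costs [C * (2 * V) `^ a] by the
    ball condition; what remains is the sum over words of [sum_prefix_prod]. *)
Let bound_sum :
  \sum_(bb <- pairs) r^-1 * (atom_weight bb.1 * atom_weight bb.2) * bound bb <=
  C * 2 `^ a * D0 * (1 - kappa)^-1.
Proof.
have [a0 a1] := andP a_01.
have -> : \sum_(bb <- pairs) r^-1 * (atom_weight bb.1 * atom_weight bb.2) * bound bb =
  \sum_(w <- words N) \sum_(v <- words N) word_weight p w * word_weight p v *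
    (H r w v * \sum_(q <- s) q.2 * mass s (fun y => `|y - q.1| <= 2 * V r w v)).
  rewrite /pairs big_allpairs_dep/= sum_atoms exchange_big/=.
  apply: eq_bigr => w _; under eq_bigr do rewrite sum_atoms/= exchange_big/=.
  rewrite exchange_big/=; apply: eq_bigr => v _.
  rewrite !mulr_sumr; apply: eq_bigr => q _.
  rewrite [in RHS]/mass [in RHS]big_mkcond/= !mulr_sumr; apply: eq_bigr => q' _.
  rewrite /bound /atom_weight/=; case: ifP => _; last by rewrite !mulr0.
  by rewrite mulr1; field; rewrite gt_eqF.
have D0_ge0 : 0 <= D0.
  by rewrite !mulr_ge0// addr_ge0// ?divr_ge0// ?mulr_ge0// ltW.
apply: (@le_trans _ _ (C * 2 `^ a * D0 *
    \sum_(w <- words N) \sum_(v <- words N) word_weight p w * word_weight p v *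
       prefix_prod (fun k => u k `^ a / l k) w v)); last first.
  apply: ler_wpM2l.
    by apply: mulr_ge0 D0_ge0; apply: mulr_ge0 => //; exact: powR_ge0.
  apply: sum_prefix_prod => //.
  by move=> k; rewrite divr_ge0 ?powR_ge0// ltW.
rewrite mulr_sumr; apply: ler_sum => w _; rewrite mulr_sumr; apply: ler_sum => v _.
rewrite [leRHS]mulrCA; apply: ler_wpM2l; first by rewrite mulr_ge0 ?word_weight_ge0.
have V0 : 0 < V r w v by rewrite lt_max r_gt0.
have rV : r <= 2 * V r w v.
  have : r <= V r w v by rewrite le_max lexx.
  by move: r_gt0; lra.
have inner : \sum_(q <- s) q.2 * mass s (fun y => `|y - q.1| <= 2 * V r w v) <=
    C * (2 * V r w v) `^ a.
  rewrite -[leRHS]mul1r -[X in _ <= X * _]s_mass /mass mulr_suml.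
  rewrite big_seq [leRHS]big_seq; apply: ler_sum => q qs.
  by apply: ler_wpM2l; [exact: s_ge0|exact: s_ball].
apply: le_trans (ler_wpM2l (H_ge0 _ _ r_gt0) inner) _.
rewrite powRM ?(ltW V0)// prefix_prod_powR//.
have := HV_le w v r_gt0; rewrite -/(U w v) -/(l_ w v) => HV.
have -> : H r w v * (C * (2 `^ a * V r w v `^ a)) =
  C * 2 `^ a * (H r w v * V r w v `^ a) by ring.
rewrite -[leRHS]mulrA; apply: ler_wpM2l; last exact: HV.
by apply: mulr_ge0 => //; exact: powR_ge0.
Qed.

Lemma energy_ge0 L : 0 <= energy L.
Proof.
rewrite mulr_ge0 ?invr_ge0 ?(ltW r_gt0)//.
rewrite big_seq; apply: sumr_ge0 => b ba; rewrite big_seq; apply: sumr_ge0 => b' b'a.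
by apply: mulr_ge0 => //; apply: mulr_ge0; exact: atom_weight_ge0.
Qed.

Lemma energy_integral : measurable_fun B energy /\
  (\int[mu]_(L in B) (energy L)%:E <= (C * 2 `^ a * D0 * (1 - kappa)^-1)%:E)%E.
Proof.
have [bb|mE iE] := @integral_sum_indic_le _ _ _ mu B _ pairs
    (fun bb => r^-1 * (atom_weight bb.1 * atom_weight bb.2)) bound coin mB.
  move=> /allpairsP[[b b'] /= [ba b'a ->]]; split.
  - apply: mulr_ge0; first by rewrite invr_ge0 ltW.
    by apply: mulr_ge0; exact: atom_weight_ge0.
  - exact: measurable_coincidence.
  - by move=> L [].
  - have [_ /size_words sw] := mem_atoms ba; have [_ /size_words sv] := mem_atoms b'a.
    apply: coincidence_le => //=; first by rewrite sw sv.
    move=> <-; apply: le_trans theta_r; rewrite -sw; apply: prefix_prod_diag => k.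
    by rewrite ltW//= u_theta.
split; first by apply: eq_measurable_fun mE => L; rewrite inE => /energyE.
apply: le_trans (le_trans _ iE) _; last by rewrite lee_fin bound_sum.
by rewrite (eq_integral _ _ (fun L BL => congr1 EFin (energyE (set_mem BL)))).
Qed.

Lemma measure_ge_of_atoms_energy (L : 'rV[R]_n.+1) (A : set R) (M : R) : 0 < M ->
  (forall b, b \in atoms -> exists2 y, A y & `|atom_pos L b - y| <= r) ->
  energy L <= M -> (M^-1%:E <= lebesgue_measure (thickening (2 * r) A))%E.
Proof.
move=> M0 near EM.
apply: (@measure_ge_of_energy _ r M A
  [seq (atom_pos L b, atom_weight b) | b <- atoms]) => //.
- by move=> _ /mapP[b ba ->]; exact: atom_weight_ge0.
- by rewrite /mass big_map/= sum_atom_weight.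
- by move=> _ /mapP[b ba ->]; exact: near.
rewrite big_map/=; under eq_bigr do rewrite big_map/= big_mkcond/=.
move: EM; rewrite /energy mulrC ler_pdivrMr// => EM; apply: le_trans EM.
rewrite le_eqVlt; apply/orP; left; apply/eqP; apply: eq_bigr => b _.
by apply: eq_bigr => b' _; case: ifP => _; rewrite ?mulr1 ?mulr0.
Qed.

End one_scale.

(** The scale of the words of length [N] is [theta ^+ N], a bound for the size of
    their cylinders.  Along the scales where the energy stays below [M], the
    neighbourhoods of [S L] have measure at least [M^-1]. *)
Lemma ae_positive_measure (K : set R) (S : 'rV[R]_n.+1 -> set R) :
  (forall r, 0 < r -> exists s, [/\ forall q, q \in s -> K q.1 /\ 0 <= q.2,
     mass s predT = 1 & forall x t, r <= t ->
       mass s (fun y => `|y - x| <= t) <= C * t `^ a]) ->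
  (forall L, B L -> compact (S L)) ->
  (forall L x w, B L -> K x ->
     exists2 y, S L y & `|x + z w L - y| <= theta ^+ size w) ->
  {ae mu, forall L, B L -> (0 < lebesgue_measure (S L))%E}.
Proof.
move=> frost Sc near; have [t0 t1] := andP theta_01.
have tN N : 0 < theta ^+ N by exact: exprn_gt0.
pose s N := sval (cid (frost _ (tN N))).
have sP N : [/\ forall q, q \in s N -> K q.1 /\ 0 <= q.2,
     mass (s N) predT = 1 & forall x t, theta ^+ N <= t ->
       mass (s N) (fun y => `|y - x| <= t) <= C * t `^ a].
  exact: svalP (cid (frost _ (tN N))).
have s0 N q : q \in s N -> 0 <= q.2 by have [sK _ _] := sP N; move=> /sK[].
have s1 N : mass (s N) predT = 1 by have [] := sP N.
have sb N : forall x t, theta ^+ N <= t ->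
    mass (s N) (fun y => `|y - x| <= t) <= C * t `^ a by have [] := sP N.
have EI N := energy_integral (tN N) (lexx _) (s0 N) (s1 N) (sb N).
have := @ae_frequently_bounded _ _ _ mu B _ _ mB
  (fun N => (EI N).1) _ (fun N => (EI N).2).
have E0 N L : B L -> 0 <= energy (theta ^+ N) N (s N) L.
  by move=> _; apply: energy_ge0; [exact: tN|exact: s0].
move=> /(_ E0); apply: filterS => L bddL BL; have [M M0 ML] := bddL BL.
apply: (@lt_le_trans _ _ M^-1%:E); first by rewrite lte_fin invr_gt0.
apply: compact_measure_ge; first exact: Sc.
move=> e e0.
have : (2 : R) * theta ^+ k @[k --> \oo] --> (2 : R) * 0.
  by apply: cvgMr; apply: cvg_expr; rewrite ger0_norm// ltW.
rewrite mulr0 => /cvgr0Pnorm_lt /(_ e e0)[N0 _ small].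
have [N N0N EN] := ML N0.
apply: (@le_trans _ _ (lebesgue_measure (thickening (2 * theta ^+ N) (S L)))).
  apply: (measure_ge_of_atoms_energy (tN N) (s0 N) (s1 N) M0 _ EN).
  move=> b /mem_atoms[bs /size_words <-]; have [/(_ _ bs)[Kb _] _ _] := sP N.
  exact: near.
apply: le_measure; rewrite ?inE.
- by apply: measurable_thickening; rewrite mulr_gt0.
- exact: measurable_thickening.
move=> x [y Sy yx]; exists y => //; apply: le_ball yx.
by rewrite ltW// (le_lt_trans (ler_norm _))// small.
Qed.

End energy.

(** * Relative differentiability on a box *)

Section relative_C1.
Context {R : realType} {m : nat}.
Implicit Types (f : 'rV[R]_m -> R) (A : set 'rV[R]_m).

Lemma rV_norm_le (v : 'rV[R]_m) e : 0 <= e -> (forall i, `|v ord0 i| <= e) -> `|v| <= e.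
Proof.
move=> e0 ve; rewrite /Num.norm/= mx_normrE; apply/bigmax_leP; split => // -[i j] _ /=.
by rewrite ord1.
Qed.

Lemma littleo_cube A f (x : 'rV[R]_m) : f =o_ (within A (nbhs x)) (fun y => y - x) ->
  forall eps, 0 < eps -> exists2 e, 0 < e &
    forall y, A y -> cube x e y -> `|f y| <= eps * `|y - x|.
Proof.
move=> fo eps eps0.
have : \forall y \near within A (nbhs x), `|f y| <= eps * `|y - x|.
  by rewrite fo; apply: littleoP.
by move=> /nbhs_cube[e e0 eP]; exists e => // y Ay ye; exact: eP.
Qed.

Lemma C1_on_cvg A f x eps : C1_on A f -> A x -> 0 < eps ->
  exists2 e, 0 < e & forall y, A y -> cube x e y -> `|f y - f x| <= eps.
Proof.
move=> [g [_ gP]] Ax eps0.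
have [e1 e10 e1P] := littleo_cube (gP x Ax) (ltr01 : 0 < 1 :> R).
pose G := \sum_i `|g i x|.
have G0 : 0 <= G by exact: sumr_ge0.
have G1 : 0 < 1 + G by lra.
exists (Num.min e1 (eps / (1 + G))); first by rewrite lt_min e10 divr_gt0.
move=> y Ay ye.
have y1 : cube x e1 y by move=> i; have := ye i; rewrite lt_min => /andP[].
have y2 i : `|y ord0 i - x ord0 i| <= eps / (1 + G).
  by have := ye i; rewrite lt_min => /andP[_ /ltW].
have ep : 0 <= eps / (1 + G) by rewrite divr_ge0 ?ltW.
have n1 : `|y - x| <= eps / (1 + G) by apply: rV_norm_le => // i; rewrite !mxE.
have := e1P y Ay y1; set S := \sum_(i < m) _; rewrite mul1r => h.
have S1 : `|S| <= G * (eps / (1 + G)).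
  apply: le_trans (ler_norm_sum _ _ _) _; rewrite mulr_suml.
  by apply: ler_sum => i _; rewrite normrM ler_wpM2l.
have -> : f y - f x = (f y - f x - S) + S by rewrite subrK.
apply: le_trans (ler_normD _ _) _.
have -> : eps = eps / (1 + G) + G * (eps / (1 + G)) by field; rewrite gt_eqF.
by apply: lerD => //; exact: le_trans n1.
Qed.

Lemma C1_on_continuous A f : C1_on A f -> {within A, continuous f}.
Proof.
move=> fC; apply/subspace_continuousP => x Ax; apply/cvgrPdist_le => eps eps0.
have [e e0 eP] := C1_on_cvg fC Ax eps0.
by apply/nbhs_cube; exists e => // y ye Ay; rewrite distrC eP.
Qed.

Definition set_coord (v : 'rV[R]_m) (i : 'I_m) (t : R) : 'rV[R]_m :=
  \row_k if k == i then t else v ord0 k.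

Lemma set_coord_same v i : set_coord v i (v ord0 i) = v.
Proof. by apply/rowP => k; rewrite mxE; case: eqP => // ->. Qed.

(** The mean value theorem on the segment from [L] to [L'], which stays in the box
    because its sides are intervals; on that segment the partial derivative in
    direction [i] is within [1] of its value at [x]. *)
Lemma C1_on_local_lipschitz (J : 'I_m -> interval R) f x i :
  C1_on (box J) f -> box J x ->
  exists2 C, 0 <= C & exists2 e, 0 < e &
    forall L L', box J L -> box J L' -> cube x e L -> cube x e L' ->
      (forall k, k != i -> L ord0 k = L' ord0 k) ->
      `|f L - f L'| <= C * `|L ord0 i - L' ord0 i|.
Proof.
move=> fC Jx; have [g [gc gP]] := fC.
exists (`|g i x| + 1); first by rewrite addr_ge0.
have [e e0 eP] : exists2 e, 0 < e & forall y, box J y -> cube x e y ->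
    `|g i y| <= `|g i x| + 1.
  have /subspace_continuousP/(_ x Jx)/cvgrPdist_le/(_ 1 ltr01) := gc i.
  move=> /nbhs_cube[e e0 eP]; exists e => // y Jy ye.
  have := eP y ye Jy => /= d1; rewrite -[g i y](subrK (g i x)).
  by apply: le_trans (ler_normD _ _) _; rewrite addrC lerD2l distrC.
exists e => //.
have wlog (L L' : 'rV[R]_m) : L ord0 i < L' ord0 i ->
    box J L -> box J L' -> cube x e L -> cube x e L' ->
    (forall k, k != i -> L ord0 k = L' ord0 k) ->
    `|f L' - f L| <= (`|g i x| + 1) * `|L' ord0 i - L ord0 i|.
  move=> lt JL JL' cL cL' LL'.
  pose s t := set_coord L i t.
  have sL : s (L ord0 i) = L by exact: set_coord_same.
  have sL' : s (L' ord0 i) = L'.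
    by apply/rowP => k; rewrite mxE; case: eqP => [->//|/eqP/LL'].
  have Js t : L ord0 i <= t <= L' ord0 i -> box J (s t).
    move=> /andP[t1 t2] k; rewrite mxE; case: eqP => [->|_]; last exact: JL.
    have := JL i; have := JL' i; move: (J i) => [b1 b2]; rewrite !itv_boundlr.
    move=> /andP[_ h2] /andP[h1 _]; apply/andP; split.
      by apply: le_trans h1 _; rewrite bnd_simp.
    by apply: le_trans h2; rewrite bnd_simp.
  have cs t : L ord0 i <= t <= L' ord0 i -> cube x e (s t).
    move=> /andP[t1 t2] k; rewrite mxE; case: eqP => [->|_]; last exact: cL.
    have := cL i; have := cL' i; rewrite !ltr_norml => /andP[? ?] /andP[? ?].
    by apply/andP; split; lra.
  have sB t t' k : s t' ord0 k - s t ord0 k = if k == i then t' - t else 0.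
    by rewrite !mxE; case: eqP => // _; rewrite subrr.
  have sBn t t' : `|s t' - s t| <= `|t' - t|.
    apply: rV_norm_le => // k; rewrite mxE [X in _ + X]mxE sB.
    by case: ifP => // _; rewrite normr0.
  have cube_s t t' (r : R) : 0 < r -> `|t' - t| < r -> cube (s t) r (s t').
    by move=> r0 tt k; rewrite sB; case: ifP => // _; rewrite normr0.
  have der t : t \in `](L ord0 i), (L' ord0 i)[ ->
      is_derive t 1 (f \o s) (g i (s t)).
    rewrite in_itv/= => /andP[t1 t2].
    have tI : L ord0 i <= t <= L' ord0 i by rewrite !ltW.
    (* The relative expansion is two-sided at [t], an interior point of the segment. *)
    suff cv : (fun h : R => h^-1 *: ((f \o s \o shift t) (h *: 1) - (f \o s) t)) @ 0^'
        --> g i (s t).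
      by apply: DeriveDef; [apply/cvg_ex; eexists; exact: cv|exact: cvg_lim].
    apply/cvgrPdist_le => eps eps0.
    have [r r0 rP] := littleo_cube (gP _ (Js t tI)) eps0.
    pose q := Num.min r (Num.min (t - L ord0 i) (L' ord0 i - t)).
    have q0 : 0 < q by rewrite !lt_min r0 !subr_gt0 t1 t2.
    apply/nbhs_ballP; exists q => //= h; rewrite /ball/= sub0r normrN => hq h0.
    have [hr ht1 ht2] : [/\ `|h| < r, `|h| < t - L ord0 i & `|h| < L' ord0 i - t].
      by move: hq; rewrite !lt_min => /and3P[].
    rewrite /shift/= [h *: 1]mulr1.
    have htI : L ord0 i <= h + t <= L' ord0 i.
      move: ht1 ht2; rewrite !ltr_norml => /andP[? ?] /andP[? ?].
      by apply/andP; split; lra.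
    have := rP (s (h + t)) (Js _ htI).
    rewrite (bigD1 i)//= big1 ?addr0; last first.
      by move=> k /negbTE ki; rewrite sB ki mulr0.
    rewrite sB eqxx addrK => /(_ (cube_s _ _ _ r0 _)); rewrite addrK => /(_ hr) le.
    have h_gt0 : 0 < `|h| by rewrite normr_gt0.
    have -> : g i (s t) - h^-1 *: (f (s (h + t)) - f (s t)) =
      - (h^-1 * (f (s (h + t)) - f (s t) - g i (s t) * h)).
      by rewrite /GRing.scale/=; field.
    rewrite normrN normrM normfV ler_pdivrMl//.
    apply: le_trans le _; rewrite mulrC ler_wpM2r ?(ltW eps0)//.
    by have := sBn t (h + t); rewrite addrK.
  have cont : {within `[(L ord0 i), (L' ord0 i)], continuous (f \o s)}.
    apply/subspace_continuousP => t /=; rewrite in_itv/= => tI.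
    apply/cvgrPdist_le => eps eps0.
    have [r r0 rP] := C1_on_cvg fC (Js t tI) eps0.
    apply/nbhs_ballP; exists r => //= t'; rewrite /ball/= => tt'.
    rewrite in_itv/= => t'I; rewrite distrC; apply: rP; first exact: Js.
    by apply: cube_s => //; rewrite distrC.
  have [c cI] := MVT lt der cont.
  rewrite /= sL sL' => ->; rewrite normrM ler_wpM2r//.
  move: cI; rewrite in_itv/= => /andP[/ltW c1 /ltW c2].
  by apply: eP; [apply: Js|apply: cs]; rewrite c1 c2.
move=> L L' JL JL' cL cL' LL'; case: (ltgtP (L ord0 i) (L' ord0 i)) => [lt|gt|eq].
- by rewrite distrC [`|L _ _ - _|]distrC; exact: wlog.
- by apply: wlog => // k /LL'.
- have -> : L = L'.
    by apply/rowP => k; have [->//|/LL'] := eqVneq k i.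
  by rewrite !subrr !normr0 mulr0.
Qed.

End relative_C1.

(** * Affine Cantor sets and exponents *)

Section cantor_facts.
Context {R : realType} {m : nat}.
Variables (d : 'I_m.+1 -> 'rV[R]_m.+1 -> R) (L : 'rV[R]_m.+1).
Hypothesis unit_maps : forall k, affine_maps d L k @` `[0, 1] `<=` `[0, 1].
Hypothesis ratio_lt1 : forall k, `|L ord0 k| < 1.

Local Notation phi := (affine_maps d L).

Lemma affine_maps_unit k x : 0 <= x <= 1 -> 0 <= phi k x <= 1.
Proof.
move=> x01; have /= := @unit_maps k (phi k x); rewrite in_itv/=; apply.
by exists x => //=; rewrite in_itv.
Qed.

Lemma continuous_affine_maps k : continuous (phi k).
Proof.
move=> x; apply: cvgD; last exact: cvg_cst.
by apply: cvgM; [exact: cvg_cst|exact: cvg_id].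
Qed.

Lemma compact_cantor_level n : compact (cantor_level phi n).
Proof.
elim: n => [|n IH]; first exact: segment_compact.
rewrite (_ : cantor_level _ _ =
    \big[setU/set0]_(k <- enum 'I_m.+1) (phi k @` cantor_level phi n)).
  apply: bigsetU_compact => k _; apply: continuous_compact => //.
  by apply: continuous_subspaceT; exact: continuous_affine_maps.
rewrite -bigcup_seq; apply/seteqP; split => x [k _ kx]; exists k => //=.
by rewrite mem_enum.
Qed.

Lemma compact_cantor_set : compact (cantor_set phi).
Proof.
apply: (@subclosed_compact _ _ (cantor_level phi 0%N)).
- apply: closed_bigI => n _; apply: compact_closed; first exact: Rhausdorff.
  exact: compact_cantor_level.
- exact: compact_cantor_level.
- by move=> x Kx; exact: Kx.
Qed.

Lemma cantor_set_unit x : cantor_set phi x -> 0 <= x <= 1.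
Proof. by move=> /(_ 0%N Logic.I) /=; rewrite in_itv. Qed.

Lemma cantor_set_stable k x : cantor_set phi x -> cantor_set phi (phi k x).
Proof.
move=> Kx [|n] _ /=; last by exists k => //; exists x => //; exact: Kx.
by rewrite in_itv/=; apply: affine_maps_unit; exact: cantor_set_unit.
Qed.

Lemma cantor_set_nonempty : exists x, cantor_set phi x.
Proof.
have r1 : L ord0 ord0 < 1 by apply: le_lt_trans (ler_norm _) (ratio_lt1 _).
have r0 : 0 < 1 - L ord0 ord0 by rewrite subr_gt0.
(* The fixed point of the first map belongs to every level. *)
pose x := d ord0 L / (1 - L ord0 ord0).
have fx : phi ord0 x = x by rewrite /affine_maps /x; field; rewrite gt_eqF.
exists x => n _; elim: n => [|n IH]; last by exists ord0 => //; exists x.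
have := @affine_maps_unit ord0 0; rewrite /affine_maps mulr0 add0r lexx ler01.
move=> /(_ isT) /andP[d0 _].
have := @affine_maps_unit ord0 1; rewrite /affine_maps mulr1 lexx ler01.
move=> /(_ isT) /andP[_ d1].
rewrite /= in_itv/= divr_ge0 ?(ltW r0)//= ler_pdivrMr// mul1r; lra.
Qed.

Lemma cantor_set_code w x : cantor_set phi x -> cantor_set phi (code_map d L w x).
Proof. by move=> Kx; elim: w => //= k w IH; exact: cantor_set_stable. Qed.

Lemma hausdorff_measure_cantor_set b : 0 < b -> \sum_k `|L ord0 k| `^ b < 1 ->
  hausdorff_measure b (cantor_set phi) = 0%E.
Proof.
move=> b0 sum1.
apply: (@self_covering_null _ m.+1 (fun k => `|L ord0 k|) phi (cantor_level phi)
  (cantor_set phi) 1) => //.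
- by move=> k x y; rewrite /affine_maps opprD addrACA subrr addr0 -mulrBr normrM.
- move=> x y /=; rewrite !in_itv/= => /andP[? ?] /andP[? ?].
  by rewrite ler_norml; apply/andP; split; lra.
- by move=> n.
- by move=> n x Kx; exact: Kx.
Qed.

Lemma code_map_near w : exists2 y, cantor_set phi y &
  `|code_map d L w 0 - y| <= word_weight (fun k => `|L ord0 k|) w.
Proof.
have [x Kx] := cantor_set_nonempty.
exists (code_map d L w x); first exact: cantor_set_code.
rewrite code_mapB normrM /word_weight normr_prod sub0r normrN.
rewrite ler_piMr ?prodr_ge0//.
by have /andP[? ?] := cantor_set_unit Kx; rewrite ger0_norm.
Qed.

End cantor_facts.

Lemma compact_sumset {R : realType} (A B : set R) : compact A -> compact B ->
  compact [set (x + y)%R | x in A & y in B].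
Proof.
move=> cA cB.
rewrite (_ : [set (x + y)%R | x in A & y in B] =
  (fun p : R * R => p.1 + p.2) @` (A `*` B)).
  apply: continuous_compact; last exact: compact_setX.
  by apply: continuous_subspaceT => p; exact: add_continuous.
apply/seteqP; split => [_ [x Ax [y By <-]]|_ [[x y] [/= Ax By] <-]].
  by exists (x, y).
by exists x => //; exists y.
Qed.

(** Both dimensions are at most [1] and their sum exceeds [1], so
    [1 - dim A2 < dim A1]; take [a] in between, then [b] between [1 - a] and
    [dim A2].  That neither measure vanishes is the definition of the dimension
    as an infimum. *)
Lemma dimension_exponents {R : realType} (A1 A2 : set R) (M : R) : 0 <= M ->
  A1 `<=` `[- M, M] -> A2 `<=` `[- M, M] ->
  (1 < hausdorff_dim A1 + hausdorff_dim A2)%E ->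
  exists a b, [/\ 0 < a <= 1, 0 < b, 1 < a + b, hausdorff_measure a A1 <> 0%E &
    hausdorff_measure b A2 <> 0%E].
Proof.
move=> M0 /(hausdorff_dim_le1 M0) + /(hausdorff_dim_le1 M0).
have := hausdorff_dim_ge0 A1; have := hausdorff_dim_ge0 A2.
case E1: (hausdorff_dim A1) => [x| |]//; case E2: (hausdorff_dim A2) => [y| |]//.
rewrite !lee_fin -EFinD lte_fin => y0 x0 x1 y1 xy1.
have [a ya ax] : exists2 a, 1 - y < a & a < x by exists ((1 - y + x) / 2); lra.
have [b ab bY] : exists2 b, 1 - a < b & b < y by exists ((1 - a + y) / 2); lra.
exists a, b; split; [by apply/andP; split; lra|lra|lra|..] => H0.
- have : (hausdorff_dim A1 <= a%:E)%E by apply: hausdorff_dim_le H0; lra.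
  by rewrite E1 lee_fin; lra.
- have : (hausdorff_dim A2 <= b%:E)%E by apply: hausdorff_dim_le H0; lra.
  by rewrite E2 lee_fin; lra.
Qed.

(** The minimum over the square of an affine function positive at the origin is
    attained at a vertex.  Were it nonpositive, the function would vanish on the
    segment from the origin to that vertex. *)
Lemma affine_square_gap {R : realType} (D A B : R) :
  (forall x y, 0 <= x <= 1 -> 0 <= y <= 1 -> D + A * x + B * y != 0) ->
  exists2 s, 0 < s & forall x y, 0 <= x <= 1 -> 0 <= y <= 1 ->
    s <= `|D + A * x + B * y|.
Proof.
move=> nz; have D0 : D != 0.
  by have := nz 0 0; rewrite !mulr0 !addr0; apply; rewrite lexx ler01.
wlog Dgt : D A B nz D0 / 0 < D.
  move=> W; have [Dgt|] := ltP 0 D; first exact: W.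
  rewrite le_eqVlt (negbTE D0)/= => Dlt.
  have [|||s s0 sP] := W (- D) (- A) (- B).
  - by move=> x y x01 y01; rewrite !mulNr -!opprD oppr_eq0 nz.
  - by rewrite oppr_eq0.
  - by rewrite oppr_gt0.
  exists s => // x y x01 y01; have := sP x y x01 y01.
  by rewrite !mulNr -!opprD normrN.
pose s := D + Num.min A 0 + Num.min B 0.
have minA (E x : R) : 0 <= x <= 1 -> Num.min E 0 <= E * x.
  by move=> /andP[x0 x1]; have [E0|E0] := leP E 0; nra.
have s0 : 0 < s.
  rewrite ltNge; apply/negP => sle.
  have Ds : 0 < D - s by lra.
  (* The affine function is [D] at the origin and [s] at the minimal vertex. *)
  pose t := D / (D - s).
  have t01 : 0 <= t <= 1.
    by rewrite /t divr_ge0 ?(ltW Dgt) ?(ltW Ds)//= ler_pdivrMr// mul1r; lra.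
  have pick (E : R) : exists2 x, 0 <= x <= 1 & E * x = t * Num.min E 0.
    have [_|_] := leP E 0; first by exists t => //; rewrite mulrC.
    by exists 0; rewrite ?lexx ?ler01// !mulr0.
  have [x x01 Ax] := pick A; have [y y01 By] := pick B.
  have := nz x y x01 y01; rewrite Ax By => /eqP; apply.
  have -> : D + t * Num.min A 0 + t * Num.min B 0 = D + t * (s - D) by rewrite /s; ring.
  by rewrite /t; field; rewrite gt_eqF.
exists s => // x y x01 y01; apply: le_trans (ler_norm _).
by rewrite /s -!addrA lerD2l lerD// minA.
Qed.

(** * Positive measure near a parameter *)

Lemma uniform_radius {R : realType} (I : finType) (P : I -> R -> Prop) :
  (forall i e e', 0 < e' -> e' <= e -> P i e -> P i e') ->
  (forall i, exists2 e, 0 < e & P i e) -> exists2 e, 0 < e & forall i, P i e.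
Proof.
move=> mono locP.
have gt0 : \forall e \near (0 : R)^'+, 0 < e by exact: nbhs_right_gt.
have evP : \forall e \near (0 : R)^'+, forall i, P i e.
  apply: (@filter_forall R I P) => i; have [e0 e00 Pe0] := locP i.
  have ee0 : \forall e \near (0 : R)^'+, e <= e0 by exact: nbhs_right_ltW.
  by apply: filterS2 gt0 ee0 => e egt ele; exact: mono Pe0.
have [r [r0 Pr]] := filter_ex (filterI gt0 evP).
by exists r.
Qed.

Lemma subset_cube {R : realType} n (v : 'rV[R]_n) e e' :
  e' <= e -> cube v e' `<=` cube v e.
Proof. by move=> ee w wc i; exact: lt_le_trans (wc i) ee. Qed.

Lemma word_weight_le {R : realType} m (c : 'I_m -> R) theta w :
  (forall k, 0 <= c k <= theta) -> word_weight c w <= theta ^+ size w.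
Proof.
move=> ct; elim: w => [|k w IH]; first by rewrite /word_weight big_nil.
have /andP[c0 c1] := ct k; rewrite /word_weight big_cons exprS ler_pM//.
by apply: prodr_ge0 => i _; have /andP[] := ct i.
Qed.

(** The gap [s] at [x0] loses at most four terms of size [s / 6] nearby, two from
    the ratios and two from the translations. *)
Lemma local_separation {R : realType} m (J : 'I_m -> interval R)
    (d : 'I_m -> 'rV[R]_m -> R) x0 i j :
  (forall k, C1_on (box J) (d k)) -> box J x0 ->
  affine_maps d x0 i @` `[0, 1] `&` affine_maps d x0 j @` `[0, 1] = set0 ->
  exists2 s, 0 < s & forall L, box J L -> cube x0 s L ->
    forall x y, 0 <= x <= 1 -> 0 <= y <= 1 ->
      s <= `|affine_maps d L i x - affine_maps d L j y|.
Proof.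
move=> dC Jx0 disj.
have [|s s0 sP] := @affine_square_gap R (d i x0 - d j x0) (x0 ord0 i) (- x0 ord0 j).
  move=> x y x01 y01; apply/negP => /eqP eq0.
  suff : (set0 : set R) (affine_maps d x0 i x) by [].
  rewrite -disj; split; first by exists x => //=; rewrite in_itv.
  exists y => /=; rewrite ?in_itv//= /affine_maps; lra.
have s60 : 0 < s / 6 by lra.
have [ei ei0 eiP] := C1_on_cvg (dC i) Jx0 s60.
have [ej ej0 ejP] := C1_on_cvg (dC j) Jx0 s60.
exists (Num.min (s / 6) (Num.min ei ej)); first by rewrite !lt_min s60 ei0 ej0.
move=> L JL cL x y /[dup] x01 /andP[x0' x1] /[dup] y01 /andP[y0 y1].
have cLs : cube x0 (s / 6) L by apply: subset_cube cL; rewrite ge_min lexx.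
have hi : `|d i L - d i x0| <= s / 6.
  by apply: eiP => //; apply: subset_cube cL; rewrite !ge_min lexx orbT.
have hj : `|d j L - d j x0| <= s / 6.
  by apply: ejP => //; apply: subset_cube cL; rewrite !ge_min lexx !orbT.
apply: (@le_trans _ _ (s / 6)); first by rewrite ge_min lexx.
have := sP x y x01 y01.
have hx : `|(L ord0 i - x0 ord0 i) * x| <= s / 6.
  rewrite normrM -[leRHS]mulr1; apply: ler_pM => //; last by rewrite ger0_norm.
  exact: ltW (cLs i).
have hy : `|(L ord0 j - x0 ord0 j) * y| <= s / 6.
  rewrite normrM -[leRHS]mulr1; apply: ler_pM => //; last by rewrite ger0_norm.
  exact: ltW (cLs j).
have -> : d i x0 - d j x0 + x0 ord0 i * x + - x0 ord0 j * y =
  (affine_maps d L i x - affine_maps d L j y) - (L ord0 i - x0 ord0 i) * x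
   + (L ord0 j - x0 ord0 j) * y - (d i L - d i x0) + (d j L - d j x0).
  by rewrite /affine_maps; ring.
set E := affine_maps d L i x - _.
move: hx hy hi hj; rewrite !ler_norml => /andP[? ?] /andP[? ?] /andP[? ?] /andP[? ?].
by rewrite !ler_normr => /orP[h|h]; apply/orP; [left|right]; lra.
Qed.

(** [p * c `^ a < c] leaves room to enlarge the numerator and to shrink the
    denominator of [c `^ a / c].  As [a <= 1], the power grows at most linearly:
    [(c + e) `^ a <= c `^ a * ((c + e) / c)]. *)
Lemma ratio_room {R : realType} (c p a : R) : 0 < c < 1 -> 0 <= p -> 0 < a <= 1 ->
  p * c `^ a < c ->
  exists2 e, 0 < e & forall e', 0 < e' -> e' <= e ->
    [/\ 0 < c - e', c + e' < 1 - e' & p * ((c + e') `^ a / (c - e')) < 1].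
Proof.
move=> /andP[c0 c1] p0 /andP[a0 a1] pc.
pose q := p * c `^ a / c.
have q1 : q < 1 by rewrite ltr_pdivrMr// mul1r.
have q0 : 0 <= q by rewrite divr_ge0 ?mulr_ge0 ?powR_ge0// ltW.
exists (Num.min (c * (1 - q) / 3) ((1 - c) / 3)).
  by rewrite lt_min; apply/andP; split; [rewrite divr_gt0// mulr_gt0//; lra|lra].
move=> e e0; rewrite le_min => /andP[e1 e2].
have ce : 0 < c - e by nra.
split => //; first lra.
rewrite mulrA ltr_pdivrMr// mul1r.
have growth : (c + e) `^ a <= c `^ a * ((c + e) / c).
  have -> : (c + e) `^ a = c `^ a * ((c + e) / c) `^ a.
    rewrite -powRM; [by rewrite mulrC divfK// gt_eqF|exact: ltW|].
    by rewrite divr_ge0// ?addr_ge0// ltW.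
  rewrite ler_wpM2l ?powR_ge0//; apply: ler1_powR => //.
  by rewrite ler_pdivlMr// mul1r lerDl ltW.
apply: (@le_lt_trans _ _ (q * (c + e))).
  apply: le_trans (ler_wpM2l p0 growth) _.
  by rewrite le_eqVlt; apply/orP; left; apply/eqP; rewrite /q; field; rewrite gt_eqF.
nra.
Qed.

Lemma anchored_measurable {R : realType} n (J : 'I_n.+1 -> interval R)
    (d : 'I_n.+1 -> 'rV[R]_n.+1 -> R) (B : set 'rV[R]_n.+1) N w :
  (forall k, C1_on (box J) (d k)) -> B `<=` box J ->
  measurable_fun B ((fun L => anchored d N L w) : _ -> R).
Proof.
move=> dC BJ; rewrite /anchored; elim: (_ ++ w) => [|k v IH] /=.
  exact: measurable_cst.
apply: measurable_funD; last first.
  apply: measurable_funS (measurable_box J) BJ _.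
  by apply: measurable_fun_within_continuous;
    [exact: measurable_box|exact: C1_on_continuous].
apply: measurable_funM => //.
by apply: measurable_funTS; exact: measurable_rV_coord.
Qed.

Section local_statement.
Context {R : realType} {n : nat}.
Variables (J : 'I_n.+1 -> interval R) (d : 'I_n.+1 -> 'rV[R]_n.+1 -> R) (K : set R).
Hypothesis J_sub : forall k, [set` J k] `<=` `](-1), 0[ `|` `]0, 1[.
Hypothesis d_C1 : forall k, C1_on (box J) (d k).
Hypothesis maps_unit : forall L, box J L ->
  forall k, affine_maps d L k @` `[0, 1] `<=` `[0, 1].
Hypothesis maps_disjoint : forall L, box J L -> forall i j, i != j ->
  affine_maps d L i @` `[0, 1] `&` affine_maps d L j @` `[0, 1] = set0.
Hypothesis K_compact : compact K.

Local Notation sumset L := [set (x + y)%R | x in K & y in cantor_set (affine_maps d L)].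

Lemma box_ratio L k : box J L -> 0 < `|L ord0 k| < 1.
Proof.
move=> /(_ k) Jk; have := @J_sub k (L ord0 k) Jk.
case; rewrite /= in_itv/= => /andP[l1 l2].
  by rewrite ltr0_norm//; apply/andP; split; lra.
by rewrite gtr0_norm// l1.
Qed.

(** Fixes the constants of the argument at [L0]: exponents, weights, a cube on
    which the moduli of the ratios stay in [[c k - e, c k + e]], and the
    anchor length [N]. *)
Lemma positive_measure_locally L0 : box J L0 ->
  (1 < hausdorff_dim K + hausdorff_dim (cantor_set (affine_maps d L0)))%E ->
  exists2 e, 0 < e & {ae lebesgue_rV n.+1, forall L, (box J `&` cube L0 e) L ->
    (0 < lebesgue_measure (sumset L))%E}.
Proof.
move=> JL0 dim.
have [M M0 KM] : exists2 M, 0 <= M & K `<=` `[- M, M].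
  have [M [_ MA]] := compact_bounded K_compact.
  exists (`|M| + 1) => [|x /(MA (`|M| + 1)) /=]; first by rewrite addr_ge0.
  by rewrite ler_norml in_itv/=; apply; have := ler_norm M; lra.
pose c k := `|L0 ord0 k|.
have c01 k : 0 < c k < 1 by exact: box_ratio.
have c0 k : 0 < c k by have /andP[] := c01 k.
have c1 k : c k < 1 by have /andP[] := c01 k.
have [|||a [b [a01 b0 ab HK HL]]] := @dimension_exponents R K
    (cantor_set (affine_maps d L0)) (M + 1) _ _ _ dim.
- by rewrite addr_ge0.
- move=> x /KM /=; rewrite !in_itv/= => /andP[? ?]; apply/andP; split; lra.
- move=> x /cantor_set_unit/andP[? ?] /=; rewrite in_itv/=; apply/andP; split; lra.
(* A sum below [1] would make the [b]-dimensional measure vanish. *)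
have sum_ge1 : 1 <= \sum_k c k `^ b.
  rewrite leNgt; apply/negP => lt1; apply: HL.
  by apply: hausdorff_measure_cantor_set => //; exact: maps_unit.
have sum_gt0 : 0 < \sum_k c k `^ b by exact: lt_le_trans sum_ge1.
pose p k := c k `^ b / \sum_k c k `^ b.
have p0 k : 0 <= p k by rewrite divr_ge0 ?powR_ge0// ltW.
have p1 : \sum_k p k = 1 by rewrite -mulr_suml divff// gt_eqF.
have pc k : p k * c k `^ a < c k.
  have cb : p k <= c k `^ b by rewrite ler_pdivrMr// ler_peMr// powR_ge0.
  apply: (@le_lt_trans _ _ (c k `^ b * c k `^ a)); first by rewrite ler_wpM2r// powR_ge0.
  rewrite -powRD; last by apply/implyP => _; rewrite gt_eqF.
  (* [c `^ (a + b) < c] since [a + b > 1] and [c < 1]. *)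
  have -> : b + a = 1 + (a + b - 1) by ring.
  rewrite powRD; last by apply/implyP => _; rewrite gt_eqF.
  rewrite powRr1 ?(ltW (c0 k))// gtr_pMr//; apply: powR_lt1; last by lra.
  by rewrite ltW ?c0 ?c1.
have [e1 e10 e1P] : exists2 e, 0 < e & forall k e', 0 < e' -> e' <= e ->
    [/\ 0 < c k - e', c k + e' < 1 - e' & p k * ((c k + e') `^ a / (c k - e')) < 1].
  apply: uniform_radius => [k e e' _ ee eP e'' e0 e''e|k]; last exact: ratio_room.
  by apply: eP => //; exact: le_trans ee.
have [e2 e20 [lip lip0 lipP]] : exists2 e, 0 < e & exists2 C, 0 <= C &
    forall L L', box J L -> box J L' -> cube L0 e L -> cube L0 e L' ->
      (forall k, k != ord0 -> L ord0 k = L' ord0 k) ->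
      forall k, `|d k L - d k L'| <= C * `|L ord0 ord0 - L' ord0 ord0|.
  pose C k := sval (cid2 (C1_on_local_lipschitz ord0 (d_C1 k) JL0)).
  have C0 k : 0 <= C k by rewrite /C; case: cid2.
  have CP k : exists2 e, 0 < e & forall L L', box J L -> box J L' ->
      cube L0 e L -> cube L0 e L' ->
      (forall k, k != ord0 -> L ord0 k = L' ord0 k) ->
      `|d k L - d k L'| <= C k * `|L ord0 ord0 - L' ord0 ord0|.
    by rewrite /C; case: cid2.
  have [|e e0 eP] := uniform_radius _ CP.
    move=> k e e' _ ee eP L L' JL JL' cL cL'.
    by apply: eP => //; [apply: subset_cube cL|apply: subset_cube cL'].
  exists e => //; exists (\sum_k C k); first exact: sumr_ge0.
  move=> L L' JL JL' cL cL' LL' k; apply: le_trans (eP k _ _ JL JL' cL cL' LL') _.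
  by rewrite ler_wpM2r// (bigD1 k)//= lerDl sumr_ge0.
have [e3 e30 sepP] : exists2 e, 0 < e & forall ij : 'I_n.+1 * 'I_n.+1,
    ij.1 != ij.2 -> forall L, box J L -> cube L0 e L ->
    forall x y, 0 <= x <= 1 -> 0 <= y <= 1 ->
      e <= `|affine_maps d L ij.1 x - affine_maps d L ij.2 y|.
  apply: uniform_radius.
    move=> ij e e' e'0 ee eP neq L JL cL x y x01 y01; apply: (le_trans ee).
    by apply: eP => //; apply: subset_cube cL.
  move=> [i j]; have [eq|neq] := eqVneq i j; first by exists 1 => // /eqP.
  have [e e0 eP] := local_separation d_C1 JL0 (maps_disjoint JL0 neq).
  by exists e.
pose e := Num.min e1 (Num.min e2 e3).
have e0 : 0 < e by rewrite !lt_min e10 e20 e30.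
have ee1 : e <= e1 by rewrite ge_min lexx.
have ee2 : e <= e2 by rewrite !ge_min lexx orbT.
have ee3 : e <= e3 by rewrite !ge_min lexx !orbT.
pose l k := c k - e; pose u k := c k + e; pose theta := 1 - e.
have luP k : [/\ 0 < l k, u k < theta & p k * (u k `^ a / l k) < 1].
  exact: e1P.
have l0 k : 0 < l k by have [] := luP k.
have lu k : l k <= u k by rewrite /l /u; lra.
have utheta k : u k <= theta by have [_ /ltW] := luP k.
have theta1 : theta < 1 by rewrite /theta; lra.
have theta0 : 0 < theta.
  by apply: lt_le_trans (utheta ord0); exact: lt_le_trans (lu ord0).
have [kappa kappa01 kappaP] : exists2 kappa, 0 <= kappa < 1 &
    forall k, p k * (u k `^ a / l k) <= kappa.
  have [|k|e4 e40 e4P] :=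
    @uniform_radius R _ (fun k e => p k * (u k `^ a / l k) <= 1 - e).
  - by move=> k x x' _ xx /le_trans; apply; lra.
  - exists (1 - p k * (u k `^ a / l k)); last lra.
    by have [_ _ ?] := luP k; lra.
  exists (1 - e4) => //; apply/andP; split; last lra.
  by apply: le_trans (e4P ord0); rewrite mulr_ge0// divr_ge0 ?powR_ge0// ltW.
set B := box J `&` cube L0 e.
have BJ : B `<=` box J by move=> L [].
have mB : measurable B.
  by apply: measurableI; [exact: measurable_box|exact: measurable_cube].
have Bratio L : B L -> forall k, l k <= `|L ord0 k| <= u k.
  move=> [_ /= cL] k; have lt := cL k; rewrite /l /u /c.
  have := ler_dist_dist (L ord0 k) (L0 ord0 k); rewrite ler_norml => /andP[? ?].
  by apply/andP; split; lra.
have Bsign L L' : B L -> B L' -> 0 < L ord0 ord0 * L' ord0 ord0.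
  have ec : e < c ord0 by have := l0 ord0; rewrite /l; lra.
  move=> [_ /(_ ord0) + ] [_ /(_ ord0)]; rewrite !ltr_norml => /andP[? ?] /andP[? ?].
  move: ec; rewrite /c; have [pos|neg] := leP 0 (L0 ord0 ord0).
    by rewrite ger0_norm// => ec; apply: mulr_gt0; lra.
  by rewrite ltr0_norm// => ec; rewrite -mulrNN; apply: mulr_gt0; lra.
have Bunit L : B L -> forall k x, 0 <= x <= 1 -> 0 <= affine_maps d L k x <= 1.
  by move=> [JL _] k x; exact: affine_maps_unit (maps_unit JL) _ _.
have Bsep L : B L -> forall i j x y, i != j -> 0 <= x <= 1 -> 0 <= y <= 1 ->
    e3 <= `|affine_maps d L i x - affine_maps d L j y|.
  move=> [JL cL] i j x y ij x01 y01; apply: (sepP (i, j)) => //.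
  exact: subset_cube cL.
have Blip L L' : B L -> B L' ->
    (forall k, k != ord0 -> L ord0 k = L' ord0 k) ->
    forall k, `|d k L - d k L'| <= lip * `|L ord0 ord0 - L' ord0 ord0|.
  move=> [JL cL] [JL' cL']; apply: lipP => //.
    exact: subset_cube cL.
  exact: subset_cube cL'.
have [N NP] : exists N : nat,
    2 * ((1 + lip) / (1 - theta)) + 1 <= N%:R * e3.
  have /archi_boundP h : 0 <= (2 * ((1 + lip) / (1 - theta)) + 1) / e3.
    apply: divr_ge0 (ltW e30); apply: addr_ge0 => //; apply: mulr_ge0 => //.
    by apply: divr_ge0; [exact: addr_ge0|rewrite subr_ge0 ltW].
  by eexists; rewrite -ler_pdivrMr//; exact: ltW h.
have [C C0 frost] := discrete_frostman (proj1 (andP a01)) M0 KM HK.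
exists e => //.
apply: (@ae_positive_measure R n n.+1 B (fun w L => anchored d N L w) L0 e
  l u p theta kappa a (l ord0 ^+ N) _ _ _ _ _ _ _ _ _ _ _ _ _ _ _ C _ K) => //.
- by move=> L [_ cL] i; exact: ltW.
- by move=> k; rewrite l0 lu.
- by rewrite theta0 theta1.
- exact: exprn_gt0.
- by move=> w; exact: anchored_measurable.
- by move=> L w v BL swv; exact: (anchoredB_le theta1 utheta Bratio Bunit).
- move=> L L' w v x BL BL' LL' swv wv.
  exact: (expanding l0 theta1 utheta lip0 e30 Bratio Bsign Bunit Bsep Blip NP).
- exact: ltW.
- move=> L [JL _]; apply: compact_sumset => //.
  by apply: compact_cantor_set; exact: maps_unit.
move=> L x w BL Kx.
have L1 k : `|L ord0 k| < 1 by have /andP[] := box_ratio k (BJ _ BL).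
have [y Ky near] := code_map_near (maps_unit (BJ _ BL)) L1 (nseq N ord0 ++ w).
exists (x + y); first by exists x => //; exists y.
rewrite opprD addrACA subrr add0r; apply: le_trans near _.
apply: le_trans (word_weight_le (theta := theta) _ _) _.
  by move=> k; rewrite normr_ge0/=; have /andP[_ /le_trans ->] := Bratio _ BL k.
rewrite size_cat size_nseq exprD ler_piMl ?exprn_ge0 ?(ltW theta0)//.
by rewrite exprn_ile1// ltW.
Qed.

End local_statement.

(** * The theorem *)

Theorem corollary1p1 (R : realType) (m : nat) (J : 'I_m -> interval R)
    (d : 'I_m -> 'rV[R]_m -> R) (K : set R)
    (m_ge2 : (2 <= m)%N)
    (J_sub : forall k, [set` J k] `<=` `](-1), 0[ `|` `]0, 1[)
    (d_C1 : forall k, C1_on (box J) (d k))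
    (maps_unit : forall L, box J L ->
      forall k, affine_maps d L k @` `[0, 1] `<=` `[0, 1])
    (maps_disjoint : forall L, box J L -> forall i j, i != j ->
      affine_maps d L i @` `[0, 1] `&` affine_maps d L j @` `[0, 1] = set0)
    (K_compact : compact K)
    (dim_gt1 : forall L, box J L ->
      (1 < hausdorff_dim K + hausdorff_dim (cantor_set (affine_maps d L)))%E) :
  {ae lebesgue_rV m, forall L : 'rV[R]_m, box J L ->
    (0 < lebesgue_measure
           [set (x + y)%R | x in K & y in cantor_set (affine_maps d L)])%E}.
Proof.
case: m m_ge2 J d J_sub d_C1 maps_unit maps_disjoint dim_gt1 => [//|n] _ J d.
move=> J_sub d_C1 maps_unit maps_disjoint dim_gt1.
apply: negligible_locally => L0 /= /not_implyP[JL0 _].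
have [e e0 ae_e] := positive_measure_locally J_sub d_C1 maps_unit maps_disjoint
  K_compact JL0 (dim_gt1 L0 JL0).
exists e => //; apply: negligibleS ae_e => L /= [/not_implyP[JL notpos] cL] pos.
by apply: notpos; exact: pos.
Qed.
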